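(* The translation $(-)^\ast$ defined in the context is a compatible translation of $\mathbf{HA}^\omega + \mathbf{iRC!}_{\mathbf{N},\mathbf{N}}$ in Homotopy Type Theory (HoTT). That is, finite types are translated as h-sets, formulas as h-propositions, and whenever a formula $\phi$ with free variables among $x_1^{\sigma_1},\dots,x_n^{\sigma_n}$ is derivable in $\mathbf{HA}^\omega + \mathbf{iRC!}_{\mathbf{N},\mathbf{N}}$, its translation is inhabited in HoTT in the context where each $x_i$ ranges over the translation of $\sigma_i$.
   Context: Finite types: $\mathbf{N}$ is a finite type, and if $\sigma,\tau$ are finite types then so are $\sigma\to\tau$ and $\sigma\times\tau$. $\mathbf{HA}^\omega$ (Heyting arithmetic in all finite types) is the many-sorted intuitionistic first-order theory with countably many variables $x^\sigma,y^\sigma,\dots$ for each finite type $\sigma$, an equality predicate $=_\sigma$ for each type, application operators, and constants for zero, successor, recursors, pairing, projections, and the combinators $\mathbf{k}$ and $\mathbf{s}$. Its axioms are those of many-sorted intuitionistic predicate logic with equality, congruence rules for equality, the usual axioms for zero and successor, the induction scheme for all formulas, and the defining equations of the constants. $\exists! y^\tau\,\phi(x,y)$ abbreviates $\exists y^\tau\phi(x,y)\land\forall y_1^\tau\forall y_2^\tau(\phi(x,y_1)\land\phi(x,y_2)\supset y_1=_\tau y_2)$, where $\supset$ is implication. $\mathbf{iRC!}_{\mathbf{N},\mathbf{N}}$ is the rule: if $\forall x^{\mathbf{N}}\exists! y^{\mathbf{N}}\,\phi(x,y)$ is derivable, then $\exists f^{\mathbf{N}\to\mathbf{N}}\forall x^{\mathbf{N}}\,\phi(x,fx)$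 is derivable; in the extended theory it applies to everything derivable in that theory. HoTT is intensional Martin-Löf type theory with universes extended with the Univalence Axiom and higher inductive types (including propositional truncation $\|A\|$ and set quotients). A type $P$ is an h-proposition if $x=_P y$ holds for all $x,y:P$; a type is an h-set if its identity types are h-propositions. A translation of one theory into another is called compatible if it preserves the meaning of logical and set-theoretical constructors, so that a proof of a theorem of the first theory is transported to a proof of its translation. The translation $(-)^\ast$: a finite type $\sigma$ goes to a pair $\sigma^\ast\equiv(\sigma^\star,p_{\sigma^\star})$ where $\mathbf{N}^\star$ is the type of natural numbers, $(\sigma\to\tau)^\star$ is $\sigma^\star\to\tau^\star$, $(\sigma\times\tau)^\star$ is $\sigma^\star\times\tau^\star$, and $p_{\sigma^\star}$ is a proof that $\sigma^\star$ is an h-set. Variables, application and constants go to variables, application and the corresponding terms. Formulas go to h-propositions: $=_\sigma$ to the identity type of $\sigma^\star$, falsum to the empty type, $\land$ to $\times$, $\supset$ to $\to$, $\forall$ to $\Pi$, $\phi\lor\psi$ to the propositional truncation of the disjoint sum, and $\exists x^\sigma\phi$ to $\|\Sigma_{(x:\sigma^\star)}\phi^\ast(x)\|$. *)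

(* Defs.v *)
From Stdlib Require Import List Arith.
Import ListNotations.

Inductive ftype : Type :=
| N : ftype
| Arr : ftype -> ftype -> ftype
| Prod : ftype -> ftype -> ftype.

Module HA.

  Definition ctx := list ftype.

  (** The syntax is intrinsically typed: [var Γ σ] is the type of de Bruijn
      indices of type [σ] in the list [Γ] of the types of the free variables. *)
  Inductive var : ctx -> ftype -> Type :=
  | vz (Γ : ctx) (σ : ftype) : var (σ :: Γ) σ
  | vs (Γ : ctx) (σ τ : ftype) : var Γ σ -> var (τ :: Γ) σ.

  Arguments vz {Γ σ}.
  Arguments vs {Γ σ τ} _.

  Inductive const : ftype -> Type :=
  | Zero : const N
  | Succ : const (Arr N N)
  | Rec (σ : ftype) : const (Arr σ (Arr (Arr σ (Arr N σ)) (Arr N σ)))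
  | Pair (σ τ : ftype) : const (Arr σ (Arr τ (Prod σ τ)))
  | Proj1 (σ τ : ftype) : const (Arr (Prod σ τ) σ)
  | Proj2 (σ τ : ftype) : const (Arr (Prod σ τ) τ)
  | K (σ τ : ftype) : const (Arr σ (Arr τ σ))
  | S (ρ σ τ : ftype) :
      const (Arr (Arr ρ (Arr σ τ)) (Arr (Arr ρ σ) (Arr ρ τ))).

  Inductive tm (Γ : ctx) : ftype -> Type :=
  | Var (σ : ftype) : var Γ σ -> tm Γ σ
  | Const (σ : ftype) : const σ -> tm Γ σ
  | App (σ τ : ftype) : tm Γ (Arr σ τ) -> tm Γ σ -> tm Γ τ.

  Arguments Var {Γ σ} _.
  Arguments Const {Γ σ} _.
  Arguments App {Γ σ τ} _ _.

  Inductive form : ctx -> Type :=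
  | Eq (Γ : ctx) (σ : ftype) : tm Γ σ -> tm Γ σ -> form Γ
  | Bot (Γ : ctx) : form Γ
  | And (Γ : ctx) : form Γ -> form Γ -> form Γ
  | Or (Γ : ctx) : form Γ -> form Γ -> form Γ
  | Imp (Γ : ctx) : form Γ -> form Γ -> form Γ
  | All (Γ : ctx) (σ : ftype) : form (σ :: Γ) -> form Γ
  | Ex (Γ : ctx) (σ : ftype) : form (σ :: Γ) -> form Γ.

  Arguments Eq {Γ σ} _ _.
  Arguments Bot {Γ}.
  Arguments And {Γ} _ _.
  Arguments Or {Γ} _ _.
  Arguments Imp {Γ} _ _.
  Arguments All {Γ} σ _.
  Arguments Ex {Γ} σ _.

  Definition Neg {Γ : ctx} (φ : form Γ) : form Γ := Imp φ Bot.

  Definition renaming (Γ Δ : ctx) : Type := forall σ : ftype, var Γ σ -> var Δ σ.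
  Definition subst (Γ Δ : ctx) : Type := forall σ : ftype, var Γ σ -> tm Δ σ.

  Definition scons {Γ Δ : ctx} {τ : ftype} (t : tm Δ τ) (s : subst Γ Δ) :
    subst (τ :: Γ) Δ :=
    fun σ v =>
      match v in var Γ' σ'
            return match Γ' with
                   | [] => unit
                   | τ' :: Γ0 => tm Δ τ' -> subst Γ0 Δ -> tm Δ σ'
                   end
      with
      | vz => fun t _ => t
      | vs w => fun _ s => s _ w
      end t s.

  Definition up_ren {Γ Δ : ctx} {τ : ftype} (r : renaming Γ Δ) :
    renaming (τ :: Γ) (τ :: Δ) :=
    fun σ v =>
      match v in var Γ' σ'
            return match Γ' with
                   | [] => unit
                   | τ' :: Γ0 => renaming Γ0 Δ -> var (τ' :: Δ) σ'
                   end
      with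
      | vz => fun _ => vz
      | vs w => fun r => vs (r _ w)
      end r.

  Fixpoint ren_tm {Γ Δ : ctx} (r : renaming Γ Δ) {σ : ftype} (t : tm Γ σ) :
    tm Δ σ :=
    match t with
    | Var v => Var (r _ v)
    | Const c => Const c
    | App t u => App (ren_tm r t) (ren_tm r u)
    end.

  Fixpoint ren {Γ Δ : ctx} (r : renaming Γ Δ) (φ : form Γ) : form Δ :=
    match φ in form Γ' return renaming Γ' Δ -> form Δ with
    | Eq t u => fun r => Eq (ren_tm r t) (ren_tm r u)
    | Bot => fun _ => Bot
    | And φ ψ => fun r => And (ren r φ) (ren r ψ)
    | Or φ ψ => fun r => Or (ren r φ) (ren r ψ)
    | Imp φ ψ => fun r => Imp (ren r φ) (ren r ψ)
    | All σ φ => fun r => All σ (ren (up_ren r) φ)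
    | Ex σ φ => fun r => Ex σ (ren (up_ren r) φ)
    end r.

  Definition wk_ren {Γ : ctx} {τ : ftype} : renaming Γ (τ :: Γ) := fun _ v => vs v.
  Definition wk_tm {Γ : ctx} {τ σ : ftype} (t : tm Γ σ) : tm (τ :: Γ) σ :=
    ren_tm wk_ren t.
  Definition wk {Γ : ctx} {τ : ftype} (φ : form Γ) : form (τ :: Γ) := ren wk_ren φ.

  Definition up {Γ Δ : ctx} {τ : ftype} (s : subst Γ Δ) : subst (τ :: Γ) (τ :: Δ) :=
    scons (Var vz) (fun _ v => wk_tm (s _ v)).

  Fixpoint sub_tm {Γ Δ : ctx} (s : subst Γ Δ) {σ : ftype} (t : tm Γ σ) : tm Δ σ :=
    match t with
    | Var v => s _ v
    | Const c => Const c
    | App t u => App (sub_tm s t) (sub_tm s u)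
    end.

  Fixpoint sub {Γ Δ : ctx} (s : subst Γ Δ) (φ : form Γ) : form Δ :=
    match φ in form Γ' return subst Γ' Δ -> form Δ with
    | Eq t u => fun s => Eq (sub_tm s t) (sub_tm s u)
    | Bot => fun _ => Bot
    | And φ ψ => fun s => And (sub s φ) (sub s ψ)
    | Or φ ψ => fun s => Or (sub s φ) (sub s ψ)
    | Imp φ ψ => fun s => Imp (sub s φ) (sub s ψ)
    | All σ φ => fun s => All σ (sub (up s) φ)
    | Ex σ φ => fun s => Ex σ (sub (up s) φ)
    end s.

  Definition inst {Γ : ctx} {σ : ftype} (φ : form (σ :: Γ)) (t : tm Γ σ) : form Γ :=
    sub (scons t (fun _ v => Var v)) φ.

  (** In the second conjunct [y2] is index 0 and [y1] is index 1. *)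
  Definition ExU {Γ : ctx} (τ : ftype) (φ : form (τ :: Γ)) : form Γ :=
    And (Ex τ φ)
        (All τ (All τ
          (Imp (And (sub (scons (Var (vs vz)) (fun _ v => Var (vs (vs v)))) φ)
                    (sub (scons (Var vz) (fun _ v => Var (vs (vs v)))) φ))
               (Eq (Var (vs vz)) (Var vz))))).

  Definition app2 {Γ : ctx} {ρ σ τ : ftype} (t : tm Γ (Arr ρ (Arr σ τ)))
    (u : tm Γ ρ) (v : tm Γ σ) : tm Γ τ := App (App t u) v.
  Definition app3 {Γ : ctx} {π ρ σ τ : ftype} (t : tm Γ (Arr π (Arr ρ (Arr σ τ))))
    (u : tm Γ π) (v : tm Γ ρ) (w : tm Γ σ) : tm Γ τ := App (App (App t u) v) w.
  Definition zero {Γ : ctx} : tm Γ N := Const Zero.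
  Definition succ {Γ : ctx} (t : tm Γ N) : tm Γ N := App (Const Succ) t.

  (** φ(S x), for φ(x) with [x] the variable of index 0 *)
  Definition at_succ {Γ : ctx} (φ : form (N :: Γ)) : form (N :: Γ) :=
    sub (scons (succ (Var vz)) (fun _ v => Var (vs v))) φ.

  (** φ(x, f x) in the context [x, f, Γ], for φ(x, y) in the context [y, x, Γ] *)
  Definition at_graph {Γ : ctx} (φ : form (N :: N :: Γ)) :
    form (N :: Arr N N :: Γ) :=
    sub (scons (App (Var (vs vz)) (Var vz))
          (scons (Var vz) (fun _ v => Var (vs (vs v))))) φ.

  (** Natural deduction. Each type has a closed term, so carrying the context Γ of
      free variables does not restrict the derivable formulas: a further variable
      can be generalized ([prf_all_i]) and instantiated ([prf_all_e]). *)
  Inductive prf : forall Γ : ctx, list (form Γ) -> form Γ -> Prop :=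
  | prf_hyp Γ H φ : In φ H -> prf Γ H φ
  | prf_bot_e Γ H φ : prf Γ H Bot -> prf Γ H φ
  | prf_and_i Γ H φ ψ : prf Γ H φ -> prf Γ H ψ -> prf Γ H (And φ ψ)
  | prf_and_e1 Γ H φ ψ : prf Γ H (And φ ψ) -> prf Γ H φ
  | prf_and_e2 Γ H φ ψ : prf Γ H (And φ ψ) -> prf Γ H ψ
  | prf_or_i1 Γ H φ ψ : prf Γ H φ -> prf Γ H (Or φ ψ)
  | prf_or_i2 Γ H φ ψ : prf Γ H ψ -> prf Γ H (Or φ ψ)
  | prf_or_e Γ H φ ψ χ :
      prf Γ H (Or φ ψ) -> prf Γ (φ :: H) χ -> prf Γ (ψ :: H) χ -> prf Γ H χ
  | prf_imp_i Γ H φ ψ : prf Γ (φ :: H) ψ -> prf Γ H (Imp φ ψ)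
  | prf_imp_e Γ H φ ψ : prf Γ H (Imp φ ψ) -> prf Γ H φ -> prf Γ H ψ
  | prf_all_i Γ H σ (φ : form (σ :: Γ)) :
      prf (σ :: Γ) (map wk H) φ -> prf Γ H (All σ φ)
  | prf_all_e Γ H σ (φ : form (σ :: Γ)) (t : tm Γ σ) :
      prf Γ H (All σ φ) -> prf Γ H (inst φ t)
  | prf_ex_i Γ H σ (φ : form (σ :: Γ)) (t : tm Γ σ) :
      prf Γ H (inst φ t) -> prf Γ H (Ex σ φ)
  | prf_ex_e Γ H σ (φ : form (σ :: Γ)) (ψ : form Γ) :
      prf Γ H (Ex σ φ) -> prf (σ :: Γ) (φ :: map wk H) (wk ψ) -> prf Γ H ψ
  | prf_refl Γ H σ (t : tm Γ σ) : prf Γ H (Eq t t)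
  | prf_sym Γ H σ (t u : tm Γ σ) : prf Γ H (Eq t u) -> prf Γ H (Eq u t)
  | prf_trans Γ H σ (t u v : tm Γ σ) :
      prf Γ H (Eq t u) -> prf Γ H (Eq u v) -> prf Γ H (Eq t v)
  | prf_cong Γ H σ τ (t t' : tm Γ (Arr σ τ)) (u u' : tm Γ σ) :
      prf Γ H (Eq t t') -> prf Γ H (Eq u u') -> prf Γ H (Eq (App t u) (App t' u'))
  | prf_repl Γ H σ (φ : form (σ :: Γ)) (t u : tm Γ σ) :
      prf Γ H (Eq t u) -> prf Γ H (inst φ t) -> prf Γ H (inst φ u)
  | prf_zero_succ Γ H (t : tm Γ N) : prf Γ H (Neg (Eq (succ t) zero))
  | prf_succ_inj Γ H (t u : tm Γ N) :
      prf Γ H (Imp (Eq (succ t) (succ u)) (Eq t u))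
  | prf_induction Γ H (φ : form (N :: Γ)) :
      prf Γ H (inst φ zero) -> prf Γ H (All N (Imp φ (at_succ φ))) ->
      prf Γ H (All N φ)
  | prf_rec_zero Γ H σ (a : tm Γ σ) (b : tm Γ (Arr σ (Arr N σ))) :
      prf Γ H (Eq (app3 (Const (Rec σ)) a b zero) a)
  | prf_rec_succ Γ H σ (a : tm Γ σ) (b : tm Γ (Arr σ (Arr N σ))) (n : tm Γ N) :
      prf Γ H (Eq (app3 (Const (Rec σ)) a b (succ n))
                  (app2 b (app3 (Const (Rec σ)) a b n) n))
  | prf_proj1 Γ H σ τ (a : tm Γ σ) (b : tm Γ τ) :
      prf Γ H (Eq (App (Const (Proj1 σ τ)) (app2 (Const (Pair σ τ)) a b)) a)
  | prf_proj2 Γ H σ τ (a : tm Γ σ) (b : tm Γ τ) :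
      prf Γ H (Eq (App (Const (Proj2 σ τ)) (app2 (Const (Pair σ τ)) a b)) b)
  | prf_surj_pair Γ H σ τ (c : tm Γ (Prod σ τ)) :
      prf Γ H (Eq (app2 (Const (Pair σ τ)) (App (Const (Proj1 σ τ)) c)
                                           (App (Const (Proj2 σ τ)) c)) c)
  | prf_k Γ H σ τ (a : tm Γ σ) (b : tm Γ τ) :
      prf Γ H (Eq (app2 (Const (K σ τ)) a b) a)
  | prf_s Γ H ρ σ τ (a : tm Γ (Arr ρ (Arr σ τ))) (b : tm Γ (Arr ρ σ)) (c : tm Γ ρ) :
      prf Γ H (Eq (app3 (Const (S ρ σ τ)) a b c) (app2 a c (App b c)))
  (* iRC!_{N,N}: the premise is derived without assumptions *)
  | prf_iRCU Γ H (φ : form (N :: N :: Γ)) :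
      prf Γ [] (All N (ExU N φ)) ->
      prf Γ H (Ex (Arr N N) (All N (at_graph φ))).

  Definition derivable {Γ : ctx} (φ : form Γ) : Prop := prf Γ [] φ.

End HA.

(** Martin-Löf type theory in the style of the first presentation in the
    appendix of the HoTT book: the only binders are Π and λ, and every other type
    former, introduction and elimination form is a constant with a closed type.
    The indices [i], [j] of the constants are universe levels; the second one is
    the level of the target of an elimination. The higher inductive types are
    propositional truncations, set quotients and pushouts. *)
Module HoTT.

  Inductive const : Type :=
  | cEmpty | cInd0 (j : nat)
  | cUnit | cStar | cInd1 (j : nat)
  | cSum (i : nat) | cInl (i : nat) | cInr (i : nat) | cCase (i j : nat)
  | cSig (i : nat) | cPair (i : nat) | cSplit (i j : nat)
  | cNat | cZero | cSucc | cNatInd (j : nat)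
  | cW (i : nat) | cSup (i : nat) | cWInd (i j : nat)
  | cId (i : nat) | cRefl (i : nat) | cJ (i j : nat)
  | cUnivalence (i : nat)
  | cTrunc (i : nat) | cTr (i : nat) | cTrPath (i : nat) | cTrInd (i j : nat)
  | cQuot (i : nat) | cQ (i : nat) | cQPath (i : nat) | cQSet (i : nat)
  | cQInd (i j : nat)
  | cPush (i : nat) | cPInl (i : nat) | cPInr (i : nat) | cGlue (i : nat)
  | cPInd (i j : nat) | cPGlueBeta (i j : nat).

  Inductive tm : Type :=
  | Var (n : nat)
  | U (i : nat)
  | Pi (A B : tm)
  | Lam (A b : tm)
  | App (f a : tm)
  | Const (c : const).

  Definition up_ren (r : nat -> nat) (n : nat) : nat :=
    match n with O => O | S m => S (r m) end.

  Fixpoint ren (r : nat -> nat) (t : tm) : tm :=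
    match t with
    | Var n => Var (r n)
    | U i => U i
    | Pi A B => Pi (ren r A) (ren (up_ren r) B)
    | Lam A b => Lam (ren r A) (ren (up_ren r) b)
    | App f a => App (ren r f) (ren r a)
    | Const c => Const c
    end.

  Definition shift (k : nat) (t : tm) : tm := ren (fun n => k + n) t.

  Definition up (s : nat -> tm) (n : nat) : tm :=
    match n with O => Var O | S m => shift 1 (s m) end.

  Fixpoint sub (s : nat -> tm) (t : tm) : tm :=
    match t with
    | Var n => s n
    | U i => U i
    | Pi A B => Pi (sub s A) (sub (up s) B)
    | Lam A b => Lam (sub s A) (sub (up s) b)
    | App f a => App (sub s f) (sub s a)
    | Const c => Const c
    end.

  Definition inst (t a : tm) : tm :=
    sub (fun n => match n with O => a | S m => Var m end) t.

  (** To write closed terms without de Bruijn indices, a term is represented as a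
      function of the number [d] of binders it is placed under; the variable bound
      at level [d] has index [d' - S d] when it occurs at level [d']. *)

  Definition oterm : Type := nat -> tm.

  Definition close (t : oterm) : tm := t 0.
  Definition oConst (c : const) : oterm := fun _ => Const c.
  Definition oU (i : nat) : oterm := fun _ => U i.
  Definition oApp (f a : oterm) : oterm := fun d => App (f d) (a d).
  Definition oPi (A : oterm) (B : oterm -> oterm) : oterm :=
    fun d => Pi (A d) (B (fun d' => Var (d' - S d)) (S d)).
  Definition oLam (A : oterm) (b : oterm -> oterm) : oterm :=
    fun d => Lam (A d) (b (fun d' => Var (d' - S d)) (S d)).

  Declare Scope oterm_scope.
  Delimit Scope oterm_scope with oterm.
  Bind Scope oterm_scope with oterm.
  Notation "f · a" := (oApp f a)
    (at level 20, left associativity) : oterm_scope.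
  Notation "A ⇒ B" := (oPi A (fun _ => B))
    (at level 55, right associativity) : oterm_scope.
  Notation "'Π' x : A , B" := (oPi A (fun x => B))
    (at level 60, x name, A at level 55, B at level 60, right associativity)
    : oterm_scope.
  Notation "'λ' x : A , b" := (oLam A (fun x => b))
    (at level 60, x name, A at level 55, b at level 60, right associativity)
    : oterm_scope.
  Local Open Scope oterm_scope.

  Definition oEmpty : oterm := oConst cEmpty.
  Definition oUnit : oterm := oConst cUnit.
  Definition oStar : oterm := oConst cStar.
  Definition oSum (i : nat) (A B : oterm) : oterm := oConst (cSum i) · A · B.
  Definition oInl (i : nat) (A B a : oterm) : oterm := oConst (cInl i) · A · B · a.
  Definition oInr (i : nat) (A B b : oterm) : oterm := oConst (cInr i) · A · B · b.
  Definition oSig (i : nat) (A B : oterm) : oterm := oConst (cSig i) · A · B.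
  Definition oTimes (i : nat) (A B : oterm) : oterm := oSig i A (λ _ : A, B).
  Definition oPair (i : nat) (A B a b : oterm) : oterm :=
    oConst (cPair i) · A · B · a · b.
  Definition oNat : oterm := oConst cNat.
  Definition oZero : oterm := oConst cZero.
  Definition oSucc (n : oterm) : oterm := oConst cSucc · n.
  Definition oW (i : nat) (A B : oterm) : oterm := oConst (cW i) · A · B.
  Definition oSup (i : nat) (A B a f : oterm) : oterm :=
    oConst (cSup i) · A · B · a · f.
  Definition oId (i : nat) (A a b : oterm) : oterm := oConst (cId i) · A · a · b.
  Definition oRefl (i : nat) (A a : oterm) : oterm := oConst (cRefl i) · A · a.
  Definition oJ (i j : nat) (A C c a b p : oterm) : oterm :=
    oConst (cJ i j) · A · C · c · a · b · p.
  Definition oTrunc (i : nat) (A : oterm) : oterm := oConst (cTrunc i) · A.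
  Definition oTr (i : nat) (A a : oterm) : oterm := oConst (cTr i) · A · a.
  Definition oTrPath (i : nat) (A x y : oterm) : oterm :=
    oConst (cTrPath i) · A · x · y.
  Definition oQuot (i : nat) (A R : oterm) : oterm := oConst (cQuot i) · A · R.
  Definition oQ (i : nat) (A R a : oterm) : oterm := oConst (cQ i) · A · R · a.
  Definition oQPath (i : nat) (A R a b r : oterm) : oterm :=
    oConst (cQPath i) · A · R · a · b · r.
  Definition oPush (i : nat) (A B C f g : oterm) : oterm :=
    oConst (cPush i) · A · B · C · f · g.
  Definition oPInl (i : nat) (A B C f g a : oterm) : oterm :=
    oConst (cPInl i) · A · B · C · f · g · a.
  Definition oPInr (i : nat) (A B C f g b : oterm) : oterm :=
    oConst (cPInr i) · A · B · C · f · g · b.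
  Definition oGlue (i : nat) (A B C f g c : oterm) : oterm :=
    oConst (cGlue i) · A · B · C · f · g · c.

  Definition oIsProp (i : nat) (A : oterm) : oterm :=
    Π x : A, Π y : A, oId i A x y.

  Definition oIsSet (i : nat) (A : oterm) : oterm :=
    Π x : A, Π y : A, oIsProp i (oId i A x y).

  Definition oTransport (i j : nat) (A P x y p u : oterm) : oterm :=
    oJ i j A (λ x : A, λ y : A, λ _ : oId i A x y, P · x ⇒ P · y)
       (λ x : A, λ u : P · x, u) x y p · u.

  (** [apd f p : transport P p (f x) = f y], for [f : Π x : A, P x] *)
  Definition oApd (i j : nat) (A P f x y p : oterm) : oterm :=
    oJ i j A
       (λ x : A, λ y : A, λ p : oId i A x y,
          oId j (P · y) (oTransport i j A P x y p (f · x)) (f · y))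
       (λ x : A, oRefl j (P · x) (f · x)) x y p.

  (** bi-invertibility *)
  Definition oIsEquiv (i : nat) (A B f : oterm) : oterm :=
    oTimes i
      (oSig i (B ⇒ A) (λ g : B ⇒ A, Π y : B, oId i B (f · (g · y)) y))
      (oSig i (B ⇒ A) (λ h : B ⇒ A, Π x : A, oId i A (h · (f · x)) x)).

  Definition oEquiv (i : nat) (A B : oterm) : oterm :=
    oSig i (A ⇒ B) (λ f : A ⇒ B, oIsEquiv i A B f).

  Definition oIdEquiv (i : nat) (A : oterm) : oterm :=
    oPair i (A ⇒ A) (λ f : A ⇒ A, oIsEquiv i A A f)
      (λ x : A, x)
      (oPair i
         (oSig i (A ⇒ A) (λ g : A ⇒ A, Π y : A, oId i A ((λ x : A, x) · (g · y)) y))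
         (λ _ : oSig i (A ⇒ A)
                  (λ g : A ⇒ A, Π y : A, oId i A ((λ x : A, x) · (g · y)) y),
            oSig i (A ⇒ A) (λ h : A ⇒ A, Π x : A, oId i A (h · ((λ x : A, x) · x)) x))
         (oPair i (A ⇒ A)
            (λ g : A ⇒ A, Π y : A, oId i A ((λ x : A, x) · (g · y)) y)
            (λ x : A, x) (λ x : A, oRefl i A x))
         (oPair i (A ⇒ A)
            (λ h : A ⇒ A, Π x : A, oId i A (h · ((λ x : A, x) · x)) x)
            (λ x : A, x) (λ x : A, oRefl i A x))).

  Definition oIdToEquiv (i : nat) (A B : oterm) : oterm :=
    λ p : oId (S i) (oU i) A B,
      oJ (S i) i (oU i)
         (λ A : oU i, λ B : oU i, λ _ : oId (S i) (oU i) A B, oEquiv i A B)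
         (λ A : oU i, oIdEquiv i A) A B p.

  (** The eliminator of a truncation has no computation constant for its path
      constructor: the second hypothesis makes every [C · x] an h-proposition, so
      the equation is derivable. The eliminator of a set quotient goes to families
      of h-sets, which amounts to a method for the constructor [cQSet]; the
      equation for [cQPath] is then derivable too. *)
  Definition const_type (c : const) : oterm :=
    match c with
    | cEmpty => oU 0
    | cInd0 j => Π C : (oEmpty ⇒ oU j), Π a : oEmpty, C · a
    | cUnit => oU 0
    | cStar => oUnit
    | cInd1 j => Π C : (oUnit ⇒ oU j), C · oStar ⇒ Π a : oUnit, C · a
    | cSum i => oU i ⇒ oU i ⇒ oU i
    | cInl i => Π A : oU i, Π B : oU i, A ⇒ oSum i A B
    | cInr i => Π A : oU i, Π B : oU i, B ⇒ oSum i A B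
    | cCase i j =>
        Π A : oU i, Π B : oU i, Π C : (oSum i A B ⇒ oU j),
        (Π a : A, C · oInl i A B a) ⇒ (Π b : B, C · oInr i A B b) ⇒
        Π s : oSum i A B, C · s
    | cSig i => Π A : oU i, (A ⇒ oU i) ⇒ oU i
    | cPair i =>
        Π A : oU i, Π B : (A ⇒ oU i), Π a : A, B · a ⇒ oSig i A B
    | cSplit i j =>
        Π A : oU i, Π B : (A ⇒ oU i), Π C : (oSig i A B ⇒ oU j),
        (Π a : A, Π b : B · a, C · oPair i A B a b) ⇒
        Π s : oSig i A B, C · s
    | cNat => oU 0
    | cZero => oNat
    | cSucc => oNat ⇒ oNat
    | cNatInd j =>
        Π C : (oNat ⇒ oU j),
        C · oZero ⇒ (Π n : oNat, C · n ⇒ C · oSucc n) ⇒ Π n : oNat, C · n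
    | cW i => Π A : oU i, (A ⇒ oU i) ⇒ oU i
    | cSup i =>
        Π A : oU i, Π B : (A ⇒ oU i), Π a : A, (B · a ⇒ oW i A B) ⇒ oW i A B
    | cWInd i j =>
        Π A : oU i, Π B : (A ⇒ oU i), Π C : (oW i A B ⇒ oU j),
        (Π a : A, Π f : (B · a ⇒ oW i A B),
           (Π b : B · a, C · (f · b)) ⇒ C · oSup i A B a f) ⇒
        Π w : oW i A B, C · w
    | cId i => Π A : oU i, A ⇒ A ⇒ oU i
    | cRefl i => Π A : oU i, Π a : A, oId i A a a
    | cJ i j =>
        Π A : oU i, Π C : (Π x : A, Π y : A, oId i A x y ⇒ oU j),
        (Π x : A, C · x · x · oRefl i A x) ⇒
        Π x : A, Π y : A, Π p : oId i A x y, C · x · y · p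
    | cUnivalence i =>
        Π A : oU i, Π B : oU i,
        oIsEquiv (S i) (oId (S i) (oU i) A B) (oEquiv i A B) (oIdToEquiv i A B)
    | cTrunc i => oU i ⇒ oU i
    | cTr i => Π A : oU i, A ⇒ oTrunc i A
    | cTrPath i => Π A : oU i, oIsProp i (oTrunc i A)
    | cTrInd i j =>
        Π A : oU i, Π C : (oTrunc i A ⇒ oU j),
        (Π a : A, C · oTr i A a) ⇒
        (Π x : oTrunc i A, Π y : oTrunc i A, Π u : C · x, Π v : C · y,
           oId j (C · y)
             (oTransport i j (oTrunc i A) C x y (oTrPath i A x y) u) v) ⇒
        Π x : oTrunc i A, C · x
    | cQuot i => Π A : oU i, (A ⇒ A ⇒ oU i) ⇒ oU i
    | cQ i => Π A : oU i, Π R : (A ⇒ A ⇒ oU i), A ⇒ oQuot i A R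
    | cQPath i =>
        Π A : oU i, Π R : (A ⇒ A ⇒ oU i), Π a : A, Π b : A,
        R · a · b ⇒ oId i (oQuot i A R) (oQ i A R a) (oQ i A R b)
    | cQSet i =>
        Π A : oU i, Π R : (A ⇒ A ⇒ oU i), oIsSet i (oQuot i A R)
    | cQInd i j =>
        Π A : oU i, Π R : (A ⇒ A ⇒ oU i), Π C : (oQuot i A R ⇒ oU j),
        (Π x : oQuot i A R, oIsSet j (C · x)) ⇒
        Π g : (Π a : A, C · oQ i A R a),
        (Π a : A, Π b : A, Π r : R · a · b,
           oId j (C · oQ i A R b)
             (oTransport i j (oQuot i A R) C (oQ i A R a) (oQ i A R b)
                (oQPath i A R a b r) (g · a))
             (g · b)) ⇒
        Π x : oQuot i A R, C · x
    | cPush i =>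
        Π A : oU i, Π B : oU i, Π C : oU i, (C ⇒ A) ⇒ (C ⇒ B) ⇒ oU i
    | cPInl i =>
        Π A : oU i, Π B : oU i, Π C : oU i, Π f : (C ⇒ A), Π g : (C ⇒ B),
        A ⇒ oPush i A B C f g
    | cPInr i =>
        Π A : oU i, Π B : oU i, Π C : oU i, Π f : (C ⇒ A), Π g : (C ⇒ B),
        B ⇒ oPush i A B C f g
    | cGlue i =>
        Π A : oU i, Π B : oU i, Π C : oU i, Π f : (C ⇒ A), Π g : (C ⇒ B),
        Π c : C,
        oId i (oPush i A B C f g)
          (oPInl i A B C f g (f · c)) (oPInr i A B C f g (g · c))
    | cPInd i j =>
        Π A : oU i, Π B : oU i, Π C : oU i, Π f : (C ⇒ A), Π g : (C ⇒ B),
        Π D : (oPush i A B C f g ⇒ oU j),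
        Π l : (Π a : A, D · oPInl i A B C f g a),
        Π r : (Π b : B, D · oPInr i A B C f g b),
        (Π c : C,
           oId j (D · oPInr i A B C f g (g · c))
             (oTransport i j (oPush i A B C f g) D
                (oPInl i A B C f g (f · c)) (oPInr i A B C f g (g · c))
                (oGlue i A B C f g c) (l · (f · c)))
             (r · (g · c))) ⇒
        Π x : oPush i A B C f g, D · x
    | cPGlueBeta i j =>
        Π A : oU i, Π B : oU i, Π C : oU i, Π f : (C ⇒ A), Π g : (C ⇒ B),
        Π D : (oPush i A B C f g ⇒ oU j),
        Π l : (Π a : A, D · oPInl i A B C f g a),
        Π r : (Π b : B, D · oPInr i A B C f g b),
        Π h : (Π c : C,
                 oId j (D · oPInr i A B C f g (g · c))
                   (oTransport i j (oPush i A B C f g) D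
                      (oPInl i A B C f g (f · c)) (oPInr i A B C f g (g · c))
                      (oGlue i A B C f g c) (l · (f · c)))
                   (r · (g · c))),
        Π c : C,
        oId j
          (oId j (D · oPInr i A B C f g (g · c))
             (oTransport i j (oPush i A B C f g) D
                (oPInl i A B C f g (f · c)) (oPInr i A B C f g (g · c))
                (oGlue i A B C f g c) (l · (f · c)))
             (r · (g · c)))
          (oApd i j (oPush i A B C f g) D
             (oConst (cPInd i j) · A · B · C · f · g · D · l · r · h)
             (oPInl i A B C f g (f · c)) (oPInr i A B C f g (g · c))
             (oGlue i A B C f g c))
          (h · c)
    end.

  (** An equation [l ≡ r : T] in a telescope. It is used in the closed form
      λ Δ, l ≡ λ Δ, r : Π Δ, T, of which the instances follow by β. *)
  Inductive equation : Type :=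
  | EqNil (l r T : oterm)
  | EqCons (A : oterm) (e : oterm -> equation).

  Fixpoint eq_lhs (e : equation) : oterm :=
    match e with EqNil l _ _ => l | EqCons A e => oLam A (fun x => eq_lhs (e x)) end.
  Fixpoint eq_rhs (e : equation) : oterm :=
    match e with EqNil _ r _ => r | EqCons A e => oLam A (fun x => eq_rhs (e x)) end.
  Fixpoint eq_type (e : equation) : oterm :=
    match e with EqNil _ _ T => T | EqCons A e => oPi A (fun x => eq_type (e x)) end.

  Declare Scope equation_scope.
  Delimit Scope equation_scope with equation.
  Bind Scope equation_scope with equation.
  Local Open Scope equation_scope.
  Notation "'∀' x : A , e" := (EqCons A%oterm (fun x => e))
    (at level 80, x name, A at level 55, e at level 80, right associativity)
    : equation_scope.
  Notation "l ≡ r ∷ T" := (EqNil l%oterm r%oterm T%oterm)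
    (at level 75, r at level 60, T at level 60, no associativity) : equation_scope.

  Inductive computation : equation -> Prop :=
  | comp_unit j : computation (
      ∀ C : (oUnit ⇒ oU j), ∀ c : C · oStar,
      oConst (cInd1 j) · C · c · oStar ≡ c ∷ C · oStar)
  | comp_inl i j : computation (
      ∀ A : oU i, ∀ B : oU i, ∀ C : (oSum i A B ⇒ oU j),
      ∀ l : (Π a : A, C · oInl i A B a), ∀ r : (Π b : B, C · oInr i A B b),
      ∀ a : A,
      oConst (cCase i j) · A · B · C · l · r · oInl i A B a ≡ l · a
        ∷ C · oInl i A B a)
  | comp_inr i j : computation (
      ∀ A : oU i, ∀ B : oU i, ∀ C : (oSum i A B ⇒ oU j),
      ∀ l : (Π a : A, C · oInl i A B a), ∀ r : (Π b : B, C · oInr i A B b),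
      ∀ b : B,
      oConst (cCase i j) · A · B · C · l · r · oInr i A B b ≡ r · b
        ∷ C · oInr i A B b)
  | comp_split i j : computation (
      ∀ A : oU i, ∀ B : (A ⇒ oU i), ∀ C : (oSig i A B ⇒ oU j),
      ∀ g : (Π a : A, Π b : B · a, C · oPair i A B a b), ∀ a : A, ∀ b : B · a,
      oConst (cSplit i j) · A · B · C · g · oPair i A B a b ≡ g · a · b
        ∷ C · oPair i A B a b)
  | comp_zero j : computation (
      ∀ C : (oNat ⇒ oU j), ∀ c : C · oZero,
      ∀ s : (Π n : oNat, C · n ⇒ C · oSucc n),
      oConst (cNatInd j) · C · c · s · oZero ≡ c ∷ C · oZero)
  | comp_succ j : computation (
      ∀ C : (oNat ⇒ oU j), ∀ c : C · oZero,
      ∀ s : (Π n : oNat, C · n ⇒ C · oSucc n), ∀ n : oNat,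
      oConst (cNatInd j) · C · c · s · oSucc n
        ≡ s · n · (oConst (cNatInd j) · C · c · s · n) ∷ C · oSucc n)
  | comp_sup i j : computation (
      ∀ A : oU i, ∀ B : (A ⇒ oU i), ∀ C : (oW i A B ⇒ oU j),
      ∀ e : (Π a : A, Π f : (B · a ⇒ oW i A B),
               (Π b : B · a, C · (f · b)) ⇒ C · oSup i A B a f),
      ∀ a : A, ∀ f : (B · a ⇒ oW i A B),
      oConst (cWInd i j) · A · B · C · e · oSup i A B a f
        ≡ e · a · f · (λ b : B · a, oConst (cWInd i j) · A · B · C · e · (f · b))
        ∷ C · oSup i A B a f)
  | comp_J i j : computation (
      ∀ A : oU i, ∀ C : (Π x : A, Π y : A, oId i A x y ⇒ oU j),
      ∀ c : (Π x : A, C · x · x · oRefl i A x), ∀ a : A,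
      oJ i j A C c a a (oRefl i A a) ≡ c · a ∷ C · a · a · oRefl i A a)
  | comp_tr i j : computation (
      ∀ A : oU i, ∀ C : (oTrunc i A ⇒ oU j), ∀ g : (Π a : A, C · oTr i A a),
      ∀ h : (Π x : oTrunc i A, Π y : oTrunc i A, Π u : C · x, Π v : C · y,
               oId j (C · y)
                 (oTransport i j (oTrunc i A) C x y (oTrPath i A x y) u) v),
      ∀ a : A,
      oConst (cTrInd i j) · A · C · g · h · oTr i A a ≡ g · a ∷ C · oTr i A a)
  | comp_q i j : computation (
      ∀ A : oU i, ∀ R : (A ⇒ A ⇒ oU i), ∀ C : (oQuot i A R ⇒ oU j),
      ∀ s : (Π x : oQuot i A R, oIsSet j (C · x)),
      ∀ g : (Π a : A, C · oQ i A R a),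
      ∀ h : (Π a : A, Π b : A, Π r : R · a · b,
               oId j (C · oQ i A R b)
                 (oTransport i j (oQuot i A R) C (oQ i A R a) (oQ i A R b)
                    (oQPath i A R a b r) (g · a))
                 (g · b)),
      ∀ a : A,
      oConst (cQInd i j) · A · R · C · s · g · h · oQ i A R a ≡ g · a
        ∷ C · oQ i A R a)
  | comp_pinl i j : computation (
      ∀ A : oU i, ∀ B : oU i, ∀ C : oU i, ∀ f : (C ⇒ A), ∀ g : (C ⇒ B),
      ∀ D : (oPush i A B C f g ⇒ oU j),
      ∀ l : (Π a : A, D · oPInl i A B C f g a),
      ∀ r : (Π b : B, D · oPInr i A B C f g b),
      ∀ h : (Π c : C,
               oId j (D · oPInr i A B C f g (g · c))
                 (oTransport i j (oPush i A B C f g) D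
                    (oPInl i A B C f g (f · c)) (oPInr i A B C f g (g · c))
                    (oGlue i A B C f g c) (l · (f · c)))
                 (r · (g · c))),
      ∀ a : A,
      oConst (cPInd i j) · A · B · C · f · g · D · l · r · h · oPInl i A B C f g a
        ≡ l · a ∷ D · oPInl i A B C f g a)
  | comp_pinr i j : computation (
      ∀ A : oU i, ∀ B : oU i, ∀ C : oU i, ∀ f : (C ⇒ A), ∀ g : (C ⇒ B),
      ∀ D : (oPush i A B C f g ⇒ oU j),
      ∀ l : (Π a : A, D · oPInl i A B C f g a),
      ∀ r : (Π b : B, D · oPInr i A B C f g b),
      ∀ h : (Π c : C,
               oId j (D · oPInr i A B C f g (g · c))
                 (oTransport i j (oPush i A B C f g) D
                    (oPInl i A B C f g (f · c)) (oPInr i A B C f g (g · c))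
                    (oGlue i A B C f g c) (l · (f · c)))
                 (r · (g · c))),
      ∀ b : B,
      oConst (cPInd i j) · A · B · C · f · g · D · l · r · h · oPInr i A B C f g b
        ≡ r · b ∷ D · oPInr i A B C f g b).

  Definition ctx := list tm.

  Inductive wf : ctx -> Prop :=
  | wf_nil : wf []
  | wf_cons Γ A i : has_type Γ A (U i) -> wf (A :: Γ)

  with has_type : ctx -> tm -> tm -> Prop :=
  | ty_var Γ n A :
      wf Γ -> nth_error Γ n = Some A -> has_type Γ (Var n) (shift (S n) A)
  | ty_univ Γ i : wf Γ -> has_type Γ (U i) (U (S i))
  | ty_cumul Γ A i : has_type Γ A (U i) -> has_type Γ A (U (S i))
  | ty_pi Γ A B i :
      has_type Γ A (U i) -> has_type (A :: Γ) B (U i) -> has_type Γ (Pi A B) (U i)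
  | ty_lam Γ A B b : has_type (A :: Γ) b B -> has_type Γ (Lam A b) (Pi A B)
  | ty_app Γ A B f a :
      has_type Γ f (Pi A B) -> has_type Γ a A -> has_type Γ (App f a) (inst B a)
  | ty_const Γ c : wf Γ -> has_type Γ (Const c) (close (const_type c))
  | ty_conv Γ a A B i :
      has_type Γ a A -> def_eq Γ A B (U i) -> has_type Γ a B

  with def_eq : ctx -> tm -> tm -> tm -> Prop :=
  | eq_refl Γ a A : has_type Γ a A -> def_eq Γ a a A
  | eq_sym Γ a b A : def_eq Γ a b A -> def_eq Γ b a A
  | eq_trans Γ a b c A : def_eq Γ a b A -> def_eq Γ b c A -> def_eq Γ a c A
  | eq_conv Γ a b A B i :
      def_eq Γ a b A -> def_eq Γ A B (U i) -> def_eq Γ a b B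
  | eq_cumul Γ A B i : def_eq Γ A B (U i) -> def_eq Γ A B (U (S i))
  | eq_pi Γ A A' B B' i :
      has_type Γ A (U i) ->
      def_eq Γ A A' (U i) -> def_eq (A :: Γ) B B' (U i) ->
      def_eq Γ (Pi A B) (Pi A' B') (U i)
  | eq_lam Γ A A' B b b' i :
      has_type Γ A (U i) ->
      def_eq Γ A A' (U i) -> def_eq (A :: Γ) b b' B ->
      def_eq Γ (Lam A b) (Lam A' b') (Pi A B)
  | eq_app Γ A B f f' a a' :
      def_eq Γ f f' (Pi A B) -> def_eq Γ a a' A ->
      def_eq Γ (App f a) (App f' a') (inst B a)
  | eq_beta Γ A B b a :
      has_type (A :: Γ) b B -> has_type Γ a A ->
      def_eq Γ (App (Lam A b) a) (inst b a) (inst B a)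
  | eq_eta Γ A B f :
      has_type Γ f (Pi A B) ->
      def_eq Γ f (Lam A (App (shift 1 f) (Var 0))) (Pi A B)
  | eq_comp Γ e :
      computation e -> wf Γ ->
      def_eq Γ (close (eq_lhs e)) (close (eq_rhs e)) (close (eq_type e)).

  Definition inhabited (Γ : ctx) (A : tm) : Prop := exists a : tm, has_type Γ a A.

  Definition Empty : tm := Const cEmpty.
  Definition Nat : tm := Const cNat.
  Definition arr (A B : tm) : tm := Pi A (shift 1 B).
  Definition Id (A a b : tm) : tm := App (App (App (Const (cId 0)) A) a) b.
  Definition Sum (A B : tm) : tm := App (App (Const (cSum 0)) A) B.
  (** [B] has the variable of type [A] as index 0. *)
  Definition Sig (A B : tm) : tm := App (App (Const (cSig 0)) A) (Lam A B).
  Definition times (A B : tm) : tm := Sig A (shift 1 B).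
  Definition Trunc (A : tm) : tm := App (Const (cTrunc 0)) A.
  Definition isProp (A : tm) : tm := App (close (λ A : oU 0, oIsProp 0 A)) A.
  Definition isSet (A : tm) : tm := App (close (λ A : oU 0, oIsSet 0 A)) A.

End HoTT.

Module Star.

  Import HoTT.
  Local Open Scope oterm_scope.

  Fixpoint ftype_star (σ : ftype) : tm :=
    match σ with
    | N => Nat
    | Arr σ τ => arr (ftype_star σ) (ftype_star τ)
    | Prod σ τ => times (ftype_star σ) (ftype_star τ)
    end.

  (** [ftype_star σ] is closed, so it can be used below any number of binders. *)
  Definition o_ftype (σ : ftype) : oterm := fun _ => ftype_star σ.

  Definition const_star {σ : ftype} (c : HA.const σ) : tm :=
    close
      match c with
      | HA.Zero => oZero
      | HA.Succ => oConst cSucc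
      | HA.Rec σ =>
          let A := o_ftype σ in
          λ a : A, λ b : (A ⇒ oNat ⇒ A), λ n : oNat,
          oConst (cNatInd 0) · (λ _ : oNat, A) · a
            · (λ m : oNat, λ r : A, b · r · m) · n
      | HA.Pair σ τ =>
          let A := o_ftype σ in
          let B := o_ftype τ in
          λ a : A, λ b : B, oPair 0 A (λ _ : A, B) a b
      | HA.Proj1 σ τ =>
          let A := o_ftype σ in
          let B := o_ftype τ in
          λ c : oTimes 0 A B,
          oConst (cSplit 0 0) · A · (λ _ : A, B) · (λ _ : oTimes 0 A B, A)
            · (λ a : A, λ b : B, a) · c
      | HA.Proj2 σ τ =>
          let A := o_ftype σ in
          let B := o_ftype τ in
          λ c : oTimes 0 A B,
          oConst (cSplit 0 0) · A · (λ _ : A, B) · (λ _ : oTimes 0 A B, B)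
            · (λ a : A, λ b : B, b) · c
      | HA.K σ τ => λ a : o_ftype σ, λ b : o_ftype τ, a
      | HA.S ρ σ τ =>
          let A := o_ftype ρ in
          let B := o_ftype σ in
          let C := o_ftype τ in
          λ x : (A ⇒ B ⇒ C), λ y : (A ⇒ B), λ z : A, x · z · (y · z)
      end.

  Definition ctx_star (Γ : HA.ctx) : ctx := map ftype_star Γ.

  Fixpoint var_star {Γ : HA.ctx} {σ : ftype} (v : HA.var Γ σ) : nat :=
    match v with
    | HA.vz => O
    | HA.vs w => S (var_star w)
    end.

  Fixpoint tm_star {Γ : HA.ctx} {σ : ftype} (t : HA.tm Γ σ) : tm :=
    match t with
    | HA.Var v => Var (var_star v)
    | HA.Const c => const_star c
    | HA.App t u => App (tm_star t) (tm_star u)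
    end.

  Fixpoint form_star {Γ : HA.ctx} (φ : HA.form Γ) : tm :=
    match φ with
    | @HA.Eq _ σ t u => Id (ftype_star σ) (tm_star t) (tm_star u)
    | HA.Bot => Empty
    | HA.And φ ψ => times (form_star φ) (form_star ψ)
    | HA.Or φ ψ => Trunc (Sum (form_star φ) (form_star ψ))
    | HA.Imp φ ψ => arr (form_star φ) (form_star ψ)
    | HA.All σ φ => Pi (ftype_star σ) (form_star φ)
    | HA.Ex σ φ => Trunc (Sig (ftype_star σ) (form_star φ))
    end.

End Star.

(* Main.v *)
Require Import Defs.
From Stdlib Require Import List Arith Lia Bool.
Import ListNotations.
Import HoTT Star.

(** Formulas are read as h-propositions, so every rule of the arithmetic has to be
    matched by a term of HoTT, and most rules are matched by an evident one. The
    mathematical content lies in four points.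

    Function extensionality ([funext_holds]) follows from the judgmental computation
    rule of the truncation. A homotopy [h] from [f] to [g] sends the two points of the
    truncation of [1 + 1], at each [x], to the pairs [(f x, refl)] and [(g x, h x)] in
    the contractible type of the paths from [f x]. The resulting function from the
    truncation to [Π x, B x] takes the values [f] and [g] up to η, and it maps the path
    between the two points to a path from [f] to [g].

    A type with a reflexive relation that is valued in h-propositions and implies
    identity is an h-set ([set_criterion_holds]). The relation is the recursively
    defined equality for the natural numbers, which also refutes [S n = 0] and gives
    the injectivity of the successor; it is pointwise equality for functions and
    componentwise equality for pairs. With extensionality, products of h-propositions
    are h-propositions, so every formula is one ([form_isProp]). This is what allows
    the eliminations of disjunction and of existence, whose translations are
    truncated.

    Unique choice ([unique_choice_holds]): if [φ(x, -)] has at most one witness, then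
    [Σ y, φ(x, y)] is an h-proposition, hence it follows from its own truncation; the
    first projections of its elements form the function.

    The soundness of derivations ([soundness]) uses a forcing interpretation: [φ] is
    forced at a context [Δ] and a substitution [s] into [Δ] when the instance by [s]
    of its translation is inhabited in [Δ]. An implication or a universal
    quantification is forced by passing to a larger context, so the rules that
    discharge hypotheses need no permutation of contexts.

    The terms of HoTT that establish these facts are written out in full and their
    typing is established by computation, with a type checker that is proved sound
    ([typechecks_sound]). Definitional equality is typed here, and the subject
    reduction that a checker usually relies on needs the injectivity of [Π], which is
    a hard theorem. The checker avoids it by inferring the type of a reduct anew
    after each step of reduction. *)

(** * Substitution in the terms of HoTT *)

Definition scons (a : tm) (s : nat -> tm) (n : nat) : tm :=
  match n with O => a | S m => s m end.

Definition wk_sub (s : nat -> tm) (n : nat) : tm := shift 1 (s n).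

Lemma ren_ext r r' t : (forall n, r n = r' n) -> ren r t = ren r' t.
Proof.
  revert r r'; induction t; simpl; intros r r' E; f_equal; auto;
    apply IHt2; intros [|m]; simpl; auto.
Qed.

Lemma sub_ext s s' t : (forall n, s n = s' n) -> sub s t = sub s' t.
Proof.
  revert s s'; induction t; simpl; intros s s' E; f_equal; auto;
    apply IHt2; intros [|m]; simpl; auto; now rewrite E.
Qed.

Lemma ren_ren r r' t : ren r' (ren r t) = ren (fun n => r' (r n)) t.
Proof.
  revert r r'; induction t; simpl; intros r r'; f_equal; auto;
    rewrite IHt2; apply ren_ext; intros [|m]; reflexivity.
Qed.

Lemma sub_ren r s t : sub s (ren r t) = sub (fun n => s (r n)) t.
Proof.
  revert r s; induction t; simpl; intros r s; f_equal; auto;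
    rewrite IHt2; apply sub_ext; intros [|m]; reflexivity.
Qed.

Lemma ren_sub r s t : ren r (sub s t) = sub (fun n => ren r (s n)) t.
Proof.
  revert r s; induction t; simpl; intros r s; f_equal; auto;
    rewrite IHt2; apply sub_ext; intros [|m]; simpl; auto;
    unfold shift; rewrite !ren_ren; reflexivity.
Qed.

Lemma up_shift s t : sub (up s) (shift 1 t) = shift 1 (sub s t).
Proof. unfold shift; rewrite sub_ren, ren_sub; reflexivity. Qed.

Lemma sub_sub s s' t : sub s' (sub s t) = sub (fun n => sub s' (s n)) t.
Proof.
  revert s s'; induction t; simpl; intros s s'; f_equal; auto;
    rewrite IHt2; apply sub_ext; intros [|m]; simpl; auto; apply up_shift.
Qed.

Lemma sub_id s t : (forall n, s n = Var n) -> sub s t = t.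
Proof.
  revert s; induction t; simpl; intros s E; f_equal; auto;
    apply IHt2; intros [|m]; simpl; auto; now rewrite E.
Qed.

Lemma ren_as_sub r t : ren r t = sub (fun n => Var (r n)) t.
Proof.
  revert r; induction t; simpl; intros r; f_equal; auto;
    rewrite IHt2; apply sub_ext; intros [|m]; reflexivity.
Qed.

Lemma sub_scons_shift a s t : sub (scons a s) (shift 1 t) = sub s t.
Proof. unfold shift; rewrite sub_ren; reflexivity. Qed.

Lemma inst_scons t a : inst t a = sub (scons a Var) t.
Proof. apply sub_ext; intros [|m]; reflexivity. Qed.

Lemma inst_shift t a : inst (shift 1 t) a = t.
Proof. rewrite inst_scons, sub_scons_shift; now apply sub_id. Qed.

Lemma inst_up s t a : inst (sub (up s) t) a = sub (scons a s) t.
Proof.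
  rewrite inst_scons, sub_sub; apply sub_ext; intros [|m]; simpl; auto.
  rewrite sub_scons_shift; now apply sub_id.
Qed.

Lemma sub_inst s t a : sub s (inst t a) = inst (sub (up s) t) (sub s a).
Proof.
  rewrite inst_up, inst_scons, sub_sub.
  apply sub_ext; intros [|m]; reflexivity.
Qed.

Lemma shift_S n t : shift (S n) t = shift 1 (shift n t).
Proof. unfold shift; now rewrite ren_ren. Qed.

Lemma ren_up_shift r t : ren (up_ren r) (shift 1 t) = shift 1 (ren r t).
Proof. unfold shift; now rewrite !ren_ren. Qed.

Lemma sub_wk_sub s t : sub (wk_sub s) t = shift 1 (sub s t).
Proof. unfold shift; now rewrite ren_sub. Qed.

Lemma shift_wk_sub t : shift 1 t = sub (wk_sub Var) t.
Proof. rewrite sub_wk_sub; now rewrite sub_id. Qed.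

Lemma sub_up s t : sub (up s) t = sub (scons (Var 0) (wk_sub s)) t.
Proof. apply sub_ext; intros [|n]; reflexivity. Qed.

(** * Typing is stable under substitution *)

Lemma const_type_closed c s : sub s (close (const_type c)) = close (const_type c).
Proof. destruct c; reflexivity. Qed.

Lemma computation_closed e s : computation e ->
  sub s (close (eq_lhs e)) = close (eq_lhs e) /\
  sub s (close (eq_rhs e)) = close (eq_rhs e) /\
  sub s (close (eq_type e)) = close (eq_type e).
Proof. intros []; repeat split. Qed.

Scheme wf_mind := Minimality for wf Sort Prop
  with has_type_mind := Minimality for has_type Sort Prop
  with def_eq_mind := Minimality for def_eq Sort Prop.
Combined Scheme typing_mind from wf_mind, has_type_mind, def_eq_mind.

(** [R Γ Δ s] stands for an admissible class of substitutions from [Γ] to [Δ]; it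
    is instantiated by renamings and then, with their help, by all well-typed
    substitutions. *)
Definition ty_stable (R : ctx -> ctx -> (nat -> tm) -> Prop) Γ a A : Prop :=
  forall Δ s, wf Δ -> R Γ Δ s -> has_type Δ (sub s a) (sub s A).

(** The rules for binders need the instance of the domain to be a type, but the
    typing of the domain is not a premise of [ty_lam]: it is a part of the
    well-formedness of the context of the premise. The induction therefore carries
    the stability of all the types in the context. *)
Fixpoint ctx_stable (R : ctx -> ctx -> (nat -> tm) -> Prop) Γ : Prop :=
  match Γ with
  | [] => True
  | A :: Γ => ctx_stable R Γ /\ exists i, ty_stable R Γ A (U i)
  end.

Lemma typing_stable (R : ctx -> ctx -> (nat -> tm) -> Prop) :
  (forall Γ Δ s n A, wf Δ -> R Γ Δ s -> nth_error Γ n = Some A ->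
     has_type Δ (s n) (sub s (shift (S n) A))) ->
  (forall Γ Δ s A i, R Γ Δ s -> has_type Δ (sub s A) (U i) ->
     R (A :: Γ) (sub s A :: Δ) (up s)) ->
  (forall Γ, wf Γ -> ctx_stable R Γ) /\
  (forall Γ a A, has_type Γ a A -> ctx_stable R Γ /\ ty_stable R Γ a A) /\
  (forall Γ a b A, def_eq Γ a b A -> ctx_stable R Γ /\
     forall Δ s, wf Δ -> R Γ Δ s -> def_eq Δ (sub s a) (sub s b) (sub s A)).
Proof.
  intros Rvar Rup; unfold ty_stable.
  assert (lift : forall Γ A Δ s, ctx_stable R (A :: Γ) -> wf Δ -> R Γ Δ s ->
            wf (sub s A :: Δ) /\ R (A :: Γ) (sub s A :: Δ) (up s)).
  { intros Γ A Δ s [_ [i HA]] HΔ Hs. specialize (HA _ _ HΔ Hs).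
    split; [exact (wf_cons _ _ i HA) | exact (Rup _ _ _ _ i Hs HA)]. }
  apply typing_mind; simpl; intros;
    repeat match goal with H : _ /\ _ |- _ => destruct H end;
    [exact I | split; eauto | ..];
    (split; [assumption |]); intros Δ s HΔ Hs.
  - eapply Rvar; eauto.
  - apply ty_univ; auto.
  - apply ty_cumul; auto.
  - destruct (lift Γ A Δ s) as [? ?]; simpl; auto. apply ty_pi; auto.
  - destruct (lift Γ A Δ s) as [? ?]; simpl; auto. apply ty_lam; auto.
  - rewrite sub_inst; eapply ty_app; auto.
  - rewrite const_type_closed; now apply ty_const.
  - eapply ty_conv; eauto.
  - apply eq_refl; auto.
  - apply eq_sym; auto.
  - eapply eq_trans; eauto.
  - eapply eq_conv; eauto.
  - apply eq_cumul; auto.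
  - destruct (lift Γ A Δ s) as [? ?]; simpl; auto. apply eq_pi; auto.
  - destruct (lift Γ A Δ s) as [? ?]; simpl; auto. eapply eq_lam; eauto.
  - rewrite sub_inst; eapply eq_app; auto.
  - destruct (lift Γ A Δ s) as [? ?]; simpl; auto.
    rewrite !sub_inst; apply eq_beta; auto.
  - cbn [sub]. rewrite up_shift. apply eq_eta; auto.
  - destruct (computation_closed e s H) as (-> & -> & ->). now apply eq_comp.
Qed.

(** Renamings are encoded as substitutions by variables to be covered by
    [typing_stable]. *)
Definition ren_ok Γ Δ (s : nat -> tm) : Prop :=
  exists r, (forall n, s n = Var (r n)) /\
  forall n A, nth_error Γ n = Some A ->
    exists A', nth_error Δ (r n) = Some A' /\ shift (S (r n)) A' = sub s (shift (S n) A).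

Definition sub_ok Γ Δ (s : nat -> tm) : Prop :=
  forall n A, nth_error Γ n = Some A -> has_type Δ (s n) (sub s (shift (S n) A)).

Lemma ren_ok_up Γ Δ s A : ren_ok Γ Δ s -> ren_ok (A :: Γ) (sub s A :: Δ) (up s).
Proof.
  intros [r [E H]]; exists (up_ren r); split.
  - intros [|n]; simpl; auto. now rewrite E.
  - intros [|n] B; simpl; intros HB.
    + injection HB as ->. eexists; split; [reflexivity|]. now rewrite up_shift.
    + destruct (H _ _ HB) as (B' & HB' & E'). exists B'; split; auto.
      now rewrite shift_S, E', (shift_S (S n)), up_shift.
Qed.

Lemma has_type_ren Γ a A Δ s : has_type Γ a A -> wf Δ -> ren_ok Γ Δ s ->
  has_type Δ (sub s a) (sub s A).
Proof.
  destruct (typing_stable ren_ok) as (_ & H & _).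
  - intros Γ' Δ' s' n B HΔ [r [E H]] HB. destruct (H _ _ HB) as (B' & HB' & E').
    rewrite E, <- E'. now apply ty_var.
  - intros; now apply ren_ok_up.
  - intros Ha; now apply H.
Qed.

Lemma ren_ok_S Γ B : ren_ok Γ (B :: Γ) (fun n => Var (S n)).
Proof.
  exists S; split; auto. intros n A HA; exists A; split; auto.
  now rewrite shift_S, <- ren_as_sub.
Qed.

Lemma has_type_wk Γ a A B : wf (B :: Γ) -> has_type Γ a A ->
  has_type (B :: Γ) (shift 1 a) (shift 1 A).
Proof.
  intros W H. unfold shift. rewrite !ren_as_sub.
  eapply has_type_ren; eauto. apply ren_ok_S.
Qed.

Lemma sub_ok_up Γ Δ s A i : sub_ok Γ Δ s -> has_type Δ (sub s A) (U i) ->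
  sub_ok (A :: Γ) (sub s A :: Δ) (up s).
Proof.
  intros H HA. assert (W := wf_cons _ _ _ HA).
  intros [|n] B; simpl; intros HB.
  - injection HB as ->. rewrite up_shift. now apply ty_var.
  - rewrite (shift_S (S n)), up_shift. apply has_type_wk; auto.
Qed.

Lemma typing_sub :
  (forall Γ, wf Γ -> ctx_stable sub_ok Γ) /\
  (forall Γ a A, has_type Γ a A -> ctx_stable sub_ok Γ /\ ty_stable sub_ok Γ a A) /\
  (forall Γ a b A, def_eq Γ a b A -> ctx_stable sub_ok Γ /\
     forall Δ s, wf Δ -> sub_ok Γ Δ s -> def_eq Δ (sub s a) (sub s b) (sub s A)).
Proof.
  apply typing_stable.
  - intros; auto.
  - intros; eapply sub_ok_up; eauto.
Qed.

Lemma has_type_sub Γ a A Δ s : has_type Γ a A -> wf Δ -> sub_ok Γ Δ s ->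
  has_type Δ (sub s a) (sub s A).
Proof. intros H; now apply typing_sub. Qed.

Lemma def_eq_sub Γ a b A Δ s : def_eq Γ a b A -> wf Δ -> sub_ok Γ Δ s ->
  def_eq Δ (sub s a) (sub s b) (sub s A).
Proof. intros H; now apply typing_sub. Qed.

Lemma sub_ok_nil Δ s : sub_ok [] Δ s.
Proof. intros [|n] A H; discriminate H. Qed.

Lemma sub_ok_scons Γ Δ A a s : sub_ok Γ Δ s -> has_type Δ a (sub s A) ->
  sub_ok (A :: Γ) Δ (scons a s).
Proof.
  intros H Ha [|n] B; simpl; intros HB.
  - injection HB as ->. now rewrite sub_scons_shift.
  - rewrite shift_S, sub_scons_shift. auto.
Qed.

Lemma sub_ok_id Γ : wf Γ -> sub_ok Γ Γ Var.
Proof. intros W n A H. rewrite sub_id by auto. now apply ty_var. Qed.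

Lemma sub_ok_wk Γ Δ s A : sub_ok Γ Δ s -> wf (A :: Δ) -> sub_ok Γ (A :: Δ) (wk_sub s).
Proof. intros H W n B HB. rewrite sub_wk_sub. apply has_type_wk; auto. Qed.

Lemma beta_sub Γ Δ s A b B i a : has_type Γ A (U i) -> has_type (A :: Γ) b B ->
  wf Δ -> sub_ok Γ Δ s -> has_type Δ a (sub s A) ->
  def_eq Δ (App (sub s (Lam A b)) a) (sub (scons a s) b) (sub (scons a s) B).
Proof.
  intros HA Hb W Hs Ha. rewrite <- !inst_up. apply eq_beta; auto.
  assert (HA' : has_type Δ (sub s A) (U i)) by now apply (has_type_sub _ _ _ _ _ HA).
  eapply has_type_sub; [exact Hb | exact (wf_cons _ _ _ HA') |].
  eapply sub_ok_up; eauto.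
Qed.

Lemma beta_sub2 Γ Δ s A B φ i j a b : has_type Γ A (U i) -> has_type (A :: Γ) B (U j) ->
  has_type (B :: A :: Γ) φ (U 0) -> wf Δ -> sub_ok Γ Δ s -> has_type Δ a (sub s A) ->
  has_type Δ b (sub (scons a s) B) ->
  def_eq Δ (App (App (sub s (Lam A (Lam B φ))) a) b) (sub (scons b (scons a s)) φ) (U 0).
Proof.
  intros HA HB Hφ W Hs Ha Hb.
  eapply eq_trans.
  - apply (eq_app _ (sub (scons a s) B) (U 0)); [|apply eq_refl, Hb].
    apply (beta_sub Γ Δ s A (Lam B φ) (Pi B (U 0)) i); auto. now apply ty_lam.
  - apply (beta_sub (A :: Γ) Δ (scons a s) B φ (U 0) j); auto. now apply sub_ok_scons.
Qed.

Lemma beta_var Γ A b B i : wf Γ -> has_type Γ A (U i) -> has_type (A :: Γ) b B ->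
  def_eq (A :: Γ) (App (shift 1 (Lam A b)) (Var 0)) b B.
Proof.
  intros W HA Hb. assert (W' := wf_cons _ _ _ HA). rewrite shift_wk_sub.
  assert (id : forall t, sub (scons (Var 0) (wk_sub Var)) t = t).
  { intros t; apply sub_id; intros [|n]; reflexivity. }
  rewrite <- (id b) at 2. rewrite <- (id B). apply (beta_sub Γ _ _ A b B i); auto.
  - apply sub_ok_wk; auto using sub_ok_id.
  - rewrite <- shift_wk_sub. now apply (ty_var _ 0).
Qed.

(** The body of a λ is recovered by a weakening and an application to the new
    variable, so equal λs have equal bodies. *)
Lemma lam_cancel Γ A b b' B i : wf Γ -> has_type Γ A (U i) ->
  has_type (A :: Γ) b B -> has_type (A :: Γ) b' B ->
  def_eq Γ (Lam A b) (Lam A b') (Pi A B) -> def_eq (A :: Γ) b b' B.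
Proof.
  intros W HA Hb Hb' E. assert (W' := wf_cons _ _ _ HA).
  eapply eq_trans; [eapply eq_sym, beta_var; eauto|].
  eapply eq_trans; [|eapply beta_var; eauto].
  replace B with (inst (sub (up (wk_sub Var)) B) (Var 0)) at 1.
  - eapply eq_app.
    + rewrite (shift_wk_sub (Lam A b)), (shift_wk_sub (Lam A b')).
      eapply (def_eq_sub _ _ _ (Pi A B)); eauto. apply sub_ok_wk; auto using sub_ok_id.
    + rewrite <- shift_wk_sub. apply eq_refl. now apply (ty_var _ 0).
  - rewrite inst_up. apply sub_id; intros [|n]; reflexivity.
Qed.

(** * A sound type checker *)

Definition const_eq_dec (c d : const) : {c = d} + {c <> d}.
Proof. decide equality; apply Nat.eq_dec. Defined.

Definition tm_eq_dec (t u : tm) : {t = u} + {t <> u}.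
Proof. decide equality; first [apply Nat.eq_dec | apply const_eq_dec]. Defined.

Definition tm_eqb (t u : tm) : bool := if tm_eq_dec t u then true else false.

Lemma tm_eqb_eq t u : tm_eqb t u = true -> t = u.
Proof. unfold tm_eqb; destruct (tm_eq_dec t u); congruence. Qed.

(** Cumulativity and conversion in one relation. *)
Definition subtype Γ A B : Prop :=
  (forall a, has_type Γ a A -> has_type Γ a B) /\
  (forall a b, def_eq Γ a b A -> def_eq Γ a b B).

Lemma subtype_refl Γ A : subtype Γ A A.
Proof. split; auto. Qed.

Lemma subtype_trans Γ A B C : subtype Γ A B -> subtype Γ B C -> subtype Γ A C.
Proof. intros [H1 H2] [H3 H4]; split; auto. Qed.

Lemma def_eq_subtype Γ A B i : def_eq Γ A B (U i) -> subtype Γ A B.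
Proof.
  intros E; split; intros; [eapply ty_conv | eapply eq_conv]; eauto.
Qed.

Lemma univ_subtype Γ i j : i <= j -> subtype Γ (U i) (U j).
Proof.
  intros H; induction H; [apply subtype_refl|].
  eapply subtype_trans; [exact IHle|].
  split; intros; [now apply ty_cumul | now apply eq_cumul].
Qed.

(** A definitional equality between open terms, used from left to right. *)
Record rule : Type :=
  { rule_ctx : ctx; rule_lhs : tm; rule_rhs : tm; rule_type : tm }.

Definition valid_rule (r : rule) : Prop :=
  def_eq (rule_ctx r) (rule_lhs r) (rule_rhs r) (rule_type r).

Fixpoint list_subst (l : list tm) : nat -> tm :=
  match l with [] => Var | a :: l => scons a (list_subst l) end.

(** The match is only a guess, which [fires] verifies by substituting. *)
Fixpoint pmatch (p t : tm) (n : nat) : option tm :=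
  match p, t with
  | Var m, t => if m =? n then Some t else None
  | App p q, App t u =>
      match pmatch q u n with Some a => Some a | None => pmatch p t n end
  | _, _ => None
  end.

Definition rule_args (r : rule) (t : tm) : list tm :=
  map (fun n => match pmatch (rule_lhs r) t n with Some a => a | None => Var 0 end)
    (seq 0 (length (rule_ctx r))).

Notation "'do' x <- e ; k" :=
  (match e with Some x => k | None => None end)
  (at level 200, x pattern, e at level 100, k at level 200).

(** [infer Γ t] is the result of a recursive call: a type of [t] together with a
    reduct of [t] by one round of reductions. Returning both at once lets a single
    induction prove the typing of [t] and the typed equality with its reduct. *)
Section Checker.

Context (rules : list rule) (infer : ctx -> tm -> option (tm * tm)).

Fixpoint as_univ (n : nat) Γ (T : tm) : option nat :=
  match n, T with
  | _, U i => Some i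
  | S n, T =>
      match infer Γ T with
      | Some (U _, T') => as_univ n Γ T'
      | _ => None
      end
  | O, _ => None
  end.

Definition infer_type (n : nat) Γ (A : tm) : option (nat * tm) :=
  do (T, A') <- infer Γ A; do i <- as_univ n Γ T; Some (i, A').

Fixpoint as_pi (n : nat) Γ (T : tm) : option (tm * tm) :=
  match n, T with
  | _, Pi A B => Some (A, B)
  | S n, T => do (_, T') <- infer_type n Γ T; as_pi n Γ T'
  | O, _ => None
  end.

(** The two types are reduced in parallel until they are syntactically equal; each of
    the intermediate types is checked again by [infer_type]. *)
Fixpoint conv (n : nat) Γ (A B : tm) : bool :=
  if tm_eqb A B then true else
  match n with
  | O => false
  | S n =>
      match A, B with
      | U i, U j => i <=? j
      | _, _ =>
          match infer_type n Γ A, infer_type n Γ B with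
          | Some (_, A'), Some (_, B') => conv n Γ A' B'
          | _, _ => false
          end
      end
  end.

Definition check (n : nat) Γ (a A : tm) : bool :=
  match infer Γ a with Some (T, _) => conv n Γ T A | None => false end.

Fixpoint check_args (n : nat) Γ (l : list tm) (Δ : ctx) : bool :=
  match l, Δ with
  | [], [] => true
  | a :: l, A :: Δ =>
      if check_args n Γ l Δ then check n Γ a (sub (list_subst l) A) else false
  | _, _ => false
  end.

(** The left-hand sides are nonlinear, and syntactic equality with the instance is
    required: arguments that are only convertible become equal by the reductions
    inside the arguments. The nested conditionals keep call-by-value evaluation from
    running the expensive test after a failed one. *)
Definition fires (n : nat) Γ (t T : tm) (r : rule) : bool :=
  let l := rule_args r t in
  if tm_eqb (sub (list_subst l) (rule_lhs r)) t then
    if tm_eqb (sub (list_subst l) (rule_type r)) T then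
      check_args n Γ l (rule_ctx r)
    else false
  else false.

Definition fire (n : nat) Γ (t T : tm) : option tm :=
  match find (fires n Γ t T) rules with
  | Some r => Some (sub (list_subst (rule_args r t)) (rule_rhs r))
  | None => None
  end.

(** To strengthen [f], the bound variable is replaced by an arbitrary term; weakening the
    result and comparing it with [f] confirms that the variable did not occur. *)
Definition eta_red Γ (A B b : tm) : option tm :=
  match b with
  | App f (Var 0) =>
      let f0 := sub (scons (Var 0) Var) f in
      if tm_eqb (shift 1 f0) f then
        match infer Γ f0 with
        | Some (F, _) => if tm_eqb F (Pi A B) then Some f0 else None
        | None => None
        end
      else None
  | _ => None
  end.

Definition infer_step (n : nat) Γ (t : tm) : option (tm * tm) :=
  match t with
  | Var k => do A <- nth_error Γ k; Some (shift (S k) A, Var k)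
  | U i => Some (U (S i), U i)
  | Pi A B =>
      do (i, A') <- infer_type n Γ A;
      do (j, B') <- infer_type n (A :: Γ) B;
      Some (U (Nat.max i j), Pi A' B')
  | Lam A b =>
      do (i, A') <- infer_type n Γ A;
      do (B, b') <- infer (A :: Γ) b;
      Some (Pi A B, match eta_red Γ A B b with Some f => f | None => Lam A' b' end)
  | App (Lam A b) a =>
      do (i, A') <- infer_type n Γ A;
      do (B, b') <- infer (A :: Γ) b;
      if check n Γ a A then Some (inst B a, inst b a) else None
  | App f a =>
      do (F, f') <- infer Γ f;
      do (A, B) <- as_pi n Γ F;
      do (A1, a') <- infer Γ a;
      if conv n Γ A1 A then
        Some (inst B a,
          match fire n Γ t (inst B a) with Some t' => t' | None => App f' a' end)
      else None
  | Const c => Some (close (const_type c), Const c)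
  end.

Definition sound : Prop := forall Γ t T t',
  infer Γ t = Some (T, t') -> wf Γ -> has_type Γ t T /\ def_eq Γ t t' T.

Context (Hrules : Forall valid_rule rules) (Hinfer : sound).

Lemma as_univ_sound n Γ T i : wf Γ -> as_univ n Γ T = Some i -> subtype Γ T (U i).
Proof.
  intros W; revert T; induction n; intros T; simpl.
  - destruct T; try discriminate. intros [= <-]; apply subtype_refl.
  - assert (H : forall o, infer Γ T = o ->
      match o with Some (U _, T') => as_univ n Γ T' | _ => None end = Some i ->
      subtype Γ T (U i)).
    { intros [[[] T']|] E; try discriminate. intros H.
      apply Hinfer in E as [_ E]; auto.
      eapply subtype_trans; [eapply def_eq_subtype, E | auto]. }
    destruct T; try solve [apply H; reflexivity].
    intros [= <-]; apply subtype_refl.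
Qed.

Lemma infer_type_sound n Γ A i A' : wf Γ -> infer_type n Γ A = Some (i, A') ->
  has_type Γ A (U i) /\ def_eq Γ A A' (U i).
Proof.
  unfold infer_type; intros W.
  destruct (infer Γ A) as [[T A1]|] eqn:E; try discriminate.
  destruct (as_univ n Γ T) eqn:E1; try discriminate. intros [= <- <-].
  apply as_univ_sound in E1 as [? ?]; auto. apply Hinfer in E as [? ?]; auto.
Qed.

Lemma as_pi_sound n Γ T A B : wf Γ -> as_pi n Γ T = Some (A, B) ->
  subtype Γ T (Pi A B).
Proof.
  intros W; revert T; induction n; intros T; simpl.
  - destruct T; try discriminate. intros [= <- <-]; apply subtype_refl.
  - assert (H : forall o, infer_type n Γ T = o ->
      match o with Some (_, T') => as_pi n Γ T' | None => None end = Some (A, B) ->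
      subtype Γ T (Pi A B)).
    { intros [[j T']|] E; try discriminate. intros H.
      apply infer_type_sound in E as [_ E]; auto.
      eapply subtype_trans; [eapply def_eq_subtype, E | auto]. }
    destruct T; try solve [apply H; reflexivity].
    intros [= <- <-]; apply subtype_refl.
Qed.

Lemma conv_sound n Γ A B : wf Γ -> conv n Γ A B = true -> subtype Γ A B.
Proof.
  intros W; revert A B; induction n; intros A B; simpl;
    destruct (tm_eqb A B) eqn:E;
    try (intros _; apply tm_eqb_eq in E as ->; apply subtype_refl);
    try discriminate.
  assert (H : match infer_type n Γ A, infer_type n Γ B with
          | Some (_, A'), Some (_, B') => conv n Γ A' B'
          | _, _ => false
          end = true -> subtype Γ A B).
  { destruct (infer_type n Γ A) as [[i A']|] eqn:EA; try discriminate.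
    destruct (infer_type n Γ B) as [[j B']|] eqn:EB; try discriminate.
    intros H. apply infer_type_sound in EA as [_ EA]; auto.
    apply infer_type_sound in EB as [_ EB]; auto.
    eapply subtype_trans; [eapply def_eq_subtype, EA|].
    eapply subtype_trans; [apply IHn, H|].
    eapply def_eq_subtype, eq_sym, EB. }
  destruct A; try exact H; destruct B; try exact H.
  intros L%Nat.leb_le; now apply univ_subtype.
Qed.

Lemma check_sound n Γ a A : wf Γ -> check n Γ a A = true -> has_type Γ a A.
Proof.
  unfold check; intros W.
  destruct (infer Γ a) as [[T a']|] eqn:E; try discriminate.
  apply Hinfer in E as [E _]; auto. intros H%conv_sound; auto. now apply H.
Qed.

Lemma check_args_sound n Γ l Δ : wf Γ -> check_args n Γ l Δ = true ->
  sub_ok Δ Γ (list_subst l).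
Proof.
  intros W; revert Δ; induction l as [|a l IH]; intros [|A Δ]; try discriminate; simpl.
  - intros _; apply sub_ok_nil.
  - destruct (check_args n Γ l Δ) eqn:H1; try discriminate. intros H2.
    apply sub_ok_scons; auto. eapply check_sound; eauto.
Qed.

Lemma fire_sound n Γ t T t' : wf Γ -> fire n Γ t T = Some t' -> def_eq Γ t t' T.
Proof.
  unfold fire; intros W. destruct (find _ _) as [r|] eqn:E; try discriminate.
  intros [= <-]. apply find_some in E as [Hr E].
  unfold fires in E.
  destruct (tm_eqb _ t) eqn:E1; try discriminate.
  destruct (tm_eqb _ T) eqn:E2; try discriminate.
  apply tm_eqb_eq in E1, E2. apply check_args_sound in E; auto.
  rewrite <- E2. rewrite <- E1 at 1.
  rewrite Forall_forall in Hrules.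
  eapply def_eq_sub; eauto. apply Hrules, Hr.
Qed.

Lemma eta_red_sound Γ A B b f : wf Γ -> eta_red Γ A B b = Some f ->
  def_eq Γ (Lam A b) f (Pi A B).
Proof.
  unfold eta_red; intros W. destruct b as [| | | |g v|]; try discriminate.
  destruct v as [[|]| | | | |]; try discriminate.
  destruct (tm_eqb _ g) eqn:E; try discriminate.
  destruct (infer Γ _) as [[F g']|] eqn:E1; try discriminate.
  destruct (tm_eqb F _) eqn:E2; try discriminate.
  intros [= <-]. apply tm_eqb_eq in E, E2. subst F. 
  rewrite <- E at 1. apply eq_sym, eq_eta. apply Hinfer in E1 as [? _]; auto.
Qed.

(** In the case of a redex [(λ A, b) a] the types of [b] and [a] are inferred directly,
    so that [eq_beta] applies without an inversion of the typing of the λ. *)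
Lemma infer_step_sound n Γ t T t' : infer_step n Γ t = Some (T, t') -> wf Γ ->
  has_type Γ t T /\ def_eq Γ t t' T.
Proof.
  intros E W; destruct t as [k|i|A B|A b|f a|c]; simpl in E.
  - destruct (nth_error Γ k) eqn:E1; try discriminate. injection E as <- <-.
    assert (has_type Γ (Var k) (shift (S k) t)) by now apply ty_var.
    split; auto. now apply eq_refl.
  - injection E as <- <-. assert (has_type Γ (U i) (U (S i))) by now apply ty_univ.
    split; auto; now apply eq_refl.
  - destruct (infer_type n Γ A) as [[i A']|] eqn:EA; try discriminate.
    destruct (infer_type n (A :: Γ) B) as [[j B']|] eqn:EB; try discriminate.
    injection E as <- <-.
    apply infer_type_sound in EA as [HA EA]; auto.
    assert (W' := wf_cons _ _ _ HA).
    apply infer_type_sound in EB as [HB EB]; auto.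
    destruct (univ_subtype Γ i (Nat.max i j)) as [? ?]; [lia|].
    destruct (univ_subtype (A :: Γ) j (Nat.max i j)) as [? ?]; [lia|].
    split; [apply ty_pi | apply eq_pi]; auto.
  - destruct (infer_type n Γ A) as [[i A']|] eqn:EA; try discriminate.
    destruct (infer (A :: Γ) b) as [[B b']|] eqn:EB; try discriminate.
    injection E as <- <-.
    apply infer_type_sound in EA as [HA EA]; auto.
    assert (W' := wf_cons _ _ _ HA).
    apply Hinfer in EB as [HB EB]; auto.
    split; [now apply ty_lam|].
    destruct (eta_red Γ A B b) eqn:E1; [now apply eta_red_sound|].
    eapply eq_lam; eauto.
  - assert (Happ : match infer Γ f with
      | Some (F, f') =>
          do (A, B) <- as_pi n Γ F;
          do (A1, a') <- infer Γ a;
          if conv n Γ A1 A then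
            Some (inst B a,
              match fire n Γ (App f a) (inst B a) with
              | Some t' => t' | None => App f' a' end)
          else None
      | None => None end = Some (T, t') ->
      has_type Γ (App f a) T /\ def_eq Γ (App f a) t' T).
    { clear E.
      destruct (infer Γ f) as [[F f']|] eqn:Ef; try discriminate.
      destruct (as_pi n Γ F) as [[A B]|] eqn:EF; try discriminate.
      destruct (infer Γ a) as [[A1 a']|] eqn:Ea; try discriminate.
      destruct (conv n Γ A1 A) eqn:EA; try discriminate.
      intros [= <- <-].
      apply Hinfer in Ef as [Hf1 Hf2]; auto. apply Hinfer in Ea as [Ha1 Ha2]; auto.
      apply conv_sound in EA as [EA1 EA2]; auto.
      apply as_pi_sound in EF as [HF1 HF2]; auto.
      split; [eapply ty_app; auto|].
      destruct (fire n Γ (App f a) (inst B a)) eqn:E;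
        [eapply fire_sound; eauto | eapply eq_app; auto]. }
    destruct f as [| | |A b| |]; try exact (Happ E).
    destruct (infer_type n Γ A) as [[i A']|] eqn:EA; try discriminate.
    destruct (infer (A :: Γ) b) as [[B b']|] eqn:EB; try discriminate.
    destruct (check n Γ a A) eqn:Ea; try discriminate.
    injection E as <- <-.
    apply infer_type_sound in EA as [HA EA]; auto.
    assert (W' := wf_cons _ _ _ HA).
    apply Hinfer in EB as [HB EB]; auto.
    apply check_sound in Ea; auto.
    split; [eapply ty_app; [now apply ty_lam | auto] | now apply eq_beta].
  - injection E as <- <-.
    assert (has_type Γ (Const c) (close (const_type c))) by now apply ty_const.
    split; auto; now apply eq_refl.
Qed.

End Checker.

Fixpoint infer (rules : list rule) (n : nat) Γ (t : tm) : option (tm * tm) :=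
  match n with
  | O => None
  | S n => infer_step rules (infer rules n) n Γ t
  end.

Lemma infer_sound rules n : Forall valid_rule rules -> sound (infer rules n).
Proof.
  intros Hr; induction n; intros Γ t T t' E W; [discriminate|].
  eapply infer_step_sound; eauto.
Qed.

(** The fuel suffices for all the terms below. *)
Definition typechecks (rules : list rule) Γ (t T : tm) : bool :=
  check (infer rules 100) 100 Γ t T.

Lemma typechecks_sound rules Γ t T : Forall valid_rule rules -> wf Γ ->
  typechecks rules Γ t T = true -> has_type Γ t T.
Proof. intros Hr W. apply check_sound; auto. now apply infer_sound. Qed.


Definition is_type (rules : list rule) Γ (A : tm) : bool :=
  if infer_type (infer rules 100) 100 Γ A then true else false.

Lemma is_type_sound rules Γ A : Forall valid_rule rules -> wf Γ ->
  is_type rules Γ A = true -> exists i, has_type Γ A (U i).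
Proof.
  unfold is_type; intros Hr W.
  destruct (infer_type _ _ _ _) as [[i A']|] eqn:E; try discriminate.
  apply infer_type_sound in E as [HA _]; eauto. now apply infer_sound.
Qed.

(** * The computation rules as rewrite rules *)

(** The computation rules equate closed λ-abstractions; as rewrite rules they are
    opened to equations between the bodies. *)
Fixpoint open_equation Γ (l r T : tm) : rule :=
  match l, r, T with
  | Lam A l, Lam _ r, Pi _ T => open_equation (A :: Γ) l r T
  | _, _, _ => Build_rule Γ l r T
  end.

(** The typing of the two sides involves no reduction by the rules themselves, so it is
    checked with the empty list of rules. *)
Fixpoint check_equation Γ (l r T : tm) : bool :=
  match l, r, T with
  | Lam A l, Lam A' r, Pi A'' T =>
      is_type [] Γ A && tm_eqb A A' && tm_eqb A A'' && check_equation (A :: Γ) l r T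
  | _, _, _ => typechecks [] Γ l T && typechecks [] Γ r T
  end.

Lemma check_equation_sound Γ l r T : wf Γ -> check_equation Γ l r T = true ->
  has_type Γ l T /\ has_type Γ r T /\
  (def_eq Γ l r T -> valid_rule (open_equation Γ l r T)).
Proof.
  revert Γ r T; induction l as [| | |A _ l IH| |];
    intros Γ r T W; cbn [check_equation open_equation]; intros H;
    try (apply andb_true_iff in H as [H1 H2]; apply typechecks_sound in H1, H2; auto).
  destruct r as [| | |A' r| |];
    try (apply andb_true_iff in H as [H1 H2]; apply typechecks_sound in H1, H2; auto).
  destruct T as [| |A'' T| | |];
    try (apply andb_true_iff in H as [H1 H2]; apply typechecks_sound in H1, H2; auto).
  apply andb_true_iff in H as [H H3]; apply andb_true_iff in H as [H H2].
  apply andb_true_iff in H as [H0 H1]. apply is_type_sound in H0 as [i HA]; auto.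
  apply tm_eqb_eq in H1, H2; subst A' A''.
  apply IH in H3 as (Hl & Hr & Hv); [|exact (wf_cons _ _ _ HA)].
  repeat split; try now apply ty_lam.
  intros E; apply Hv; eapply lam_cancel; eauto.
Qed.

Definition equation_rule (e : equation) : rule :=
  open_equation [] (close (eq_lhs e)) (close (eq_rhs e)) (close (eq_type e)).

Lemma equation_rule_valid e : computation e ->
  check_equation [] (close (eq_lhs e)) (close (eq_rhs e)) (close (eq_type e)) = true ->
  valid_rule (equation_rule e).
Proof.
  intros C H. apply check_equation_sound in H as (_ & _ & H); [|apply wf_nil].
  apply H, eq_comp; auto using wf_nil.
Qed.

(** The equation is read off the rule, which fixes the universe levels. *)
Definition eqn {e} (c : computation e) : equation := e.

Definition rules : list rule :=
  map equation_rule
    [ eqn (comp_zero 0); eqn (comp_succ 0); eqn (comp_zero 1); eqn (comp_succ 1);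
      eqn (comp_inl 0 0); eqn (comp_inr 0 0); eqn (comp_split 0 0);
      eqn (comp_J 0 0); eqn (comp_tr 0 0) ].

Lemma rules_valid : Forall valid_rule rules.
Proof.
  unfold rules; simpl.
  repeat (apply Forall_cons; [apply equation_rule_valid;
    [unfold eqn; now econstructor | vm_compute; reflexivity]|]).
  apply Forall_nil.
Qed.

(** * Identity types, truncation and function extensionality *)

Local Open Scope oterm_scope.

(** A fact inside HoTT is a closed type that is inhabited; the names in capitals below
    denote such types. *)
Definition holds (T : oterm) : Prop := inhabited [] (close T).

Ltac by_term t :=
  exists (close t); apply (typechecks_sound rules);
  [exact rules_valid | apply wf_nil | vm_compute; reflexivity].

(** A fact established before enters a term as a variable of its type: the checker
    then does not unfold and type its proof again. *)
Lemma holds_mp (T1 T2 : oterm) : holds (T1 ⇒ T2) -> holds T1 ->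
  (forall a, inst (T2 1) a = T2 0) -> holds T2.
Proof.
  intros [f Hf] [a Ha] E. exists (App f a). unfold close; rewrite <- (E a).
  eapply ty_app; eauto.
Qed.

Ltac use_lemma H := eapply holds_mp; [|exact H|reflexivity].

Notation ID := (oId 0).
Notation REFL := (oRefl 0).
Notation TRUNC := (oTrunc 0).
Notation SIG := (oSig 0).
Notation TIMES := (oTimes 0).
Notation PROP := (oIsProp 0).
Notation SET := (oIsSet 0).

Definition transport := oTransport 0 0.

Definition sym (A x y p : oterm) : oterm :=
  oJ 0 0 A (λ x : A, λ y : A, λ _ : ID A x y, ID A y x) (λ x : A, REFL A x) x y p.

Definition trans (A x y z p q : oterm) : oterm :=
  transport A (λ z : A, ID A x z) y z q p.

Definition split (A B C g s : oterm) : oterm :=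
  oConst (cSplit 0 0) · A · B · C · g · s.

Definition fst (A B s : oterm) : oterm :=
  split A B (λ _ : SIG A B, A) (λ a : A, λ b : B · a, a) s.

Definition snd (A B s : oterm) : oterm :=
  split A B (λ s : SIG A B, B · fst A B s) (λ a : A, λ b : B · a, b) s.

Definition nat_ind (C c s n : oterm) : oterm := oConst (cNatInd 0) · C · c · s · n.

(** Recursion into an h-proposition, of which [h] is the proof. *)
Definition trunc_rec (A C h g x : oterm) : oterm :=
  oConst (cTrInd 0 0) · A · (λ _ : TRUNC A, C) · g
    · (λ x : TRUNC A, λ y : TRUNC A, λ u : C, λ v : C,
         h · transport (TRUNC A) (λ _ : TRUNC A, C) x y (oTrPath 0 A x y) u · v)
    · x.

Definition AP : oterm :=
  Π A : oU 0, Π B : oU 0, Π f : (A ⇒ B), Π x : A, Π y : A,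
  ID A x y ⇒ ID B (f · x) (f · y).

Lemma ap_holds : holds AP.
Proof.
  by_term (λ A : oU 0, λ B : oU 0, λ f : (A ⇒ B), λ x : A, λ y : A, λ p : ID A x y,
    oJ 0 0 A (λ x : A, λ y : A, λ _ : ID A x y, ID B (f · x) (f · y))
      (λ x : A, REFL B (f · x)) x y p).
Qed.

(** The type of the paths from [x]. *)
Definition sing (A x : oterm) : oterm := SIG A (λ y : A, ID A x y).
Definition sing_pair (A x y p : oterm) : oterm := oPair 0 A (λ y : A, ID A x y) y p.
Definition center (A x : oterm) : oterm := sing_pair A x x (REFL A x).

Definition SING_CONTR : oterm :=
  Π A : oU 0, Π x : A, Π s : sing A x, ID (sing A x) (center A x) s.
Definition SING_PROP : oterm := Π A : oU 0, Π x : A, PROP (sing A x).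

Lemma sing_contr_holds : holds SING_CONTR.
Proof.
  by_term (λ A : oU 0, λ x : A, λ s : sing A x,
    split A (λ y : A, ID A x y) (λ s : sing A x, ID (sing A x) (center A x) s)
      (λ y : A, λ p : ID A x y,
         oJ 0 0 A
           (λ x : A, λ y : A, λ p : ID A x y,
              ID (sing A x) (center A x) (sing_pair A x y p))
           (λ x : A, REFL (sing A x) (center A x)) x y p)
      s).
Qed.

Lemma sing_prop_holds : holds SING_PROP.
Proof.
  use_lemma sing_contr_holds.
  by_term (λ contr : SING_CONTR, λ A : oU 0, λ x : A, λ s : sing A x, λ t : sing A x,
    trans (sing A x) s (center A x) t
      (sym (sing A x) (center A x) s (contr · A · x · s)) (contr · A · x · t)).
Qed.

Definition BOOL : oterm := oSum 0 oUnit oUnit.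

(** The function on the truncation of [1 + 1] with values [f] and [g] at the two points.
    Its value at [x] goes through the paths from [f x], which form an h-proposition,
    because recursion on a truncation needs one. *)
Definition interval_map (sp A B f g h i : oterm) : oterm :=
  λ x : A,
  fst (B · x) (λ y : B · x, ID (B · x) (f · x) y)
    (trunc_rec BOOL (sing (B · x) (f · x)) (sp · (B · x) · (f · x))
      (λ b : BOOL,
         oConst (cCase 0 0) · oUnit · oUnit
           · (λ _ : BOOL, sing (B · x) (f · x))
           · (λ _ : oUnit, center (B · x) (f · x))
           · (λ _ : oUnit, sing_pair (B · x) (f · x) (g · x) (h · x))
           · b)
      i).

Definition FUNEXT : oterm :=
  Π A : oU 0, Π B : (A ⇒ oU 0), Π f : (Π x : A, B · x), Π g : (Π x : A, B · x),
  (Π x : A, ID (B · x) (f · x) (g · x)) ⇒ ID (Π x : A, B · x) f g.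

(** The endpoints of the path that [ap] returns are [λ x, f x] and [λ x, g x] after
    computation, so the conversion to [f] and [g] uses η. *)
Lemma funext_holds : holds FUNEXT.
Proof.
  use_lemma sing_prop_holds. use_lemma ap_holds.
  by_term (λ ap : AP, λ sp : SING_PROP, λ A : oU 0, λ B : (A ⇒ oU 0),
    λ f : (Π x : A, B · x), λ g : (Π x : A, B · x),
    λ h : (Π x : A, ID (B · x) (f · x) (g · x)),
    ap · TRUNC BOOL · (Π x : A, B · x)
      · (λ i : TRUNC BOOL, interval_map sp A B f g h i)
      · oTr 0 BOOL (oInl 0 oUnit oUnit oStar) · oTr 0 BOOL (oInr 0 oUnit oUnit oStar)
      · oTrPath 0 BOOL (oTr 0 BOOL (oInl 0 oUnit oUnit oStar))
                       (oTr 0 BOOL (oInr 0 oUnit oUnit oStar))).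
Qed.

(** * A criterion for h-sets *)

Definition TRANS_SYM : oterm :=
  Π A : oU 0, Π x : A, Π y : A, Π p : ID A x y,
  ID (ID A y y) (trans A y x y (sym A x y p) p) (REFL A y).

Lemma trans_sym_holds : holds TRANS_SYM.
Proof.
  by_term (λ A : oU 0, λ x : A, λ y : A, λ p : ID A x y,
    oJ 0 0 A (λ x : A, λ y : A, λ p : ID A x y,
        ID (ID A y y) (trans A y x y (sym A x y p) p) (REFL A y))
      (λ x : A, REFL (ID A x x) (REFL A x)) x y p).
Qed.

Definition encode (A R r x y p : oterm) : oterm :=
  transport A (λ y : A, R · x · y) x y p (r · x).

(** Any endomap [g] of the identity types can be undone: the composite of the inverse
    of [g refl] with [g p] is [p], by path induction. *)
Definition LOOP_CANCEL : oterm :=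
  Π A : oU 0, Π g : (Π x : A, Π y : A, ID A x y ⇒ ID A x y),
  Π x : A, Π y : A, Π p : ID A x y,
  ID (ID A x y) (trans A x x y (sym A x x (g · x · x · REFL A x)) (g · x · y · p)) p.

Lemma loop_cancel_holds : holds LOOP_CANCEL.
Proof.
  use_lemma trans_sym_holds.
  by_term (λ ts : TRANS_SYM,
    λ A : oU 0, λ g : (Π x : A, Π y : A, ID A x y ⇒ ID A x y),
    λ x : A, λ y : A, λ p : ID A x y,
    oJ 0 0 A (λ x : A, λ y : A, λ p : ID A x y,
        ID (ID A x y)
          (trans A x x y (sym A x x (g · x · x · REFL A x)) (g · x · y · p)) p)
      (λ x : A, ts · A · x · x · (g · x · x · REFL A x)) x y p).
Qed.

(** If [g] is constant on each identity type, then the map that undoes it makes all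
    paths with the same endpoints equal. *)
Definition HEDBERG : oterm :=
  Π A : oU 0, Π g : (Π x : A, Π y : A, ID A x y ⇒ ID A x y),
  (Π x : A, Π y : A, Π p : ID A x y, Π q : ID A x y,
     ID (ID A x y) (g · x · y · p) (g · x · y · q)) ⇒ SET A.

Lemma hedberg_holds : holds HEDBERG.
Proof.
  use_lemma loop_cancel_holds. use_lemma ap_holds.
  by_term (λ ap : AP, λ lc : LOOP_CANCEL,
    λ A : oU 0, λ g : (Π x : A, Π y : A, ID A x y ⇒ ID A x y),
    λ h : (Π x : A, Π y : A, Π p : ID A x y, Π q : ID A x y,
     ID (ID A x y) (g · x · y · p) (g · x · y · q)),
    λ x : A, λ y : A, λ p : ID A x y, λ q : ID A x y,
    (λ k : (ID A x y ⇒ ID A x y),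
     λ c : (Π r : ID A x y, ID (ID A x y) (k · (g · x · y · r)) r),
     trans (ID A x y) p (k · (g · x · y · p)) q
       (sym (ID A x y) (k · (g · x · y · p)) p (c · p))
       (trans (ID A x y) (k · (g · x · y · p)) (k · (g · x · y · q)) q
         (ap · ID A x y · ID A x y · k · (g · x · y · p) · (g · x · y · q)
           · (h · x · y · p · q))
         (c · q)))
    · (λ r : ID A x y, trans A x x y (sym A x x (g · x · x · REFL A x)) r)
    · (lc · A · g · x · y)).
Qed.

Definition SET_CRITERION : oterm :=
  Π A : oU 0, Π R : (A ⇒ A ⇒ oU 0),
  (Π x : A, Π y : A, PROP (R · x · y)) ⇒ (Π x : A, R · x · x) ⇒
  (Π x : A, Π y : A, R · x · y ⇒ ID A x y) ⇒ SET A.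

(** The composite [x = y → R x y → x = y] is constant as [R x y] is an h-proposition. *)
Lemma set_criterion_holds : holds SET_CRITERION.
Proof.
  use_lemma hedberg_holds. use_lemma ap_holds.
  by_term (λ ap : AP, λ hedberg : HEDBERG,
    λ A : oU 0, λ R : (A ⇒ A ⇒ oU 0),
    λ h : (Π x : A, Π y : A, PROP (R · x · y)), λ r : (Π x : A, R · x · x),
    λ d : (Π x : A, Π y : A, R · x · y ⇒ ID A x y),
    hedberg · A
      · (λ x : A, λ y : A, λ p : ID A x y, d · x · y · encode A R r x y p)
      · (λ x : A, λ y : A, λ p : ID A x y, λ q : ID A x y,
           ap · (R · x · y) · ID A x y · (d · x · y)
             · encode A R r x y p · encode A R r x y q
             · (h · x · y · encode A R r x y p · encode A R r x y q))).
Qed.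

(** * The types of the arithmetic are h-sets *)

(** The recursively defined equality of natural numbers. *)
Definition code : oterm :=
  λ m : oNat,
  oConst (cNatInd 1) · (λ _ : oNat, oNat ⇒ oU 0)
    · (λ n : oNat, oConst (cNatInd 1) · (λ _ : oNat, oU 0) · oUnit
         · (λ _ : oNat, λ _ : oU 0, oEmpty) · n)
    · (λ _ : oNat, λ r : (oNat ⇒ oU 0), λ n : oNat,
         oConst (cNatInd 1) · (λ _ : oNat, oU 0) · oEmpty
         · (λ n : oNat, λ _ : oU 0, r · n) · n)
    · m.

Definition EMPTY_PROP : oterm := PROP oEmpty.
Definition UNIT_PROP : oterm := PROP oUnit.
Lemma empty_prop_holds : holds EMPTY_PROP.
Proof.
  by_term (λ x : oEmpty, λ y : oEmpty,
    oConst (cInd0 0) · (λ _ : oEmpty, ID oEmpty x y) · x).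
Qed.

Lemma unit_prop_holds : holds UNIT_PROP.
Proof.
  by_term (λ x : oUnit,
    oConst (cInd1 0) · (λ x : oUnit, Π y : oUnit, ID oUnit x y)
      · (λ y : oUnit, oConst (cInd1 0) · (λ y : oUnit, ID oUnit oStar y)
           · REFL oUnit oStar · y)
      · x).
Qed.

Definition CODE_PROP : oterm := Π m : oNat, Π n : oNat, PROP (code · m · n).
Lemma code_prop_holds : holds CODE_PROP.
Proof.
  use_lemma empty_prop_holds. use_lemma unit_prop_holds.
  by_term (λ u : UNIT_PROP, λ e : EMPTY_PROP, λ m : oNat,
    nat_ind (λ m : oNat, Π n : oNat, PROP (code · m · n))
      (λ n : oNat, nat_ind (λ n : oNat, PROP (code · oZero · n)) u
         (λ n : oNat, λ _ : PROP (code · oZero · n), e) n)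
      (λ m : oNat, λ r : (Π n : oNat, PROP (code · m · n)), λ n : oNat,
         nat_ind (λ n : oNat, PROP (code · oSucc m · n)) e
           (λ n : oNat, λ _ : PROP (code · oSucc m · n), r · n) n)
      m).
Qed.

Definition CODE_REFL : oterm := Π n : oNat, code · n · n.
Lemma code_refl_holds : holds CODE_REFL.
Proof.
  by_term (λ n : oNat, nat_ind (λ n : oNat, code · n · n) oStar
    (λ n : oNat, λ r : code · n · n, r) n).
Qed.

Definition DECODE : oterm := Π m : oNat, Π n : oNat, code · m · n ⇒ ID oNat m n.
Lemma decode_holds : holds DECODE.
Proof.
  use_lemma ap_holds.
  by_term (λ ap : AP, λ m : oNat,
    nat_ind (λ m : oNat, Π n : oNat, code · m · n ⇒ ID oNat m n)
      (λ n : oNat, nat_ind (λ n : oNat, code · oZero · n ⇒ ID oNat oZero n)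
         (λ _ : oUnit, REFL oNat oZero)
         (λ n : oNat, λ _ : (code · oZero · n ⇒ ID oNat oZero n), λ e : oEmpty,
            oConst (cInd0 0) · (λ _ : oEmpty, ID oNat oZero (oSucc n)) · e) n)
      (λ m : oNat, λ r : (Π n : oNat, code · m · n ⇒ ID oNat m n), λ n : oNat,
         nat_ind (λ n : oNat, code · oSucc m · n ⇒ ID oNat (oSucc m) n)
         (λ e : oEmpty,
            oConst (cInd0 0) · (λ _ : oEmpty, ID oNat (oSucc m) oZero) · e)
         (λ n : oNat, λ _ : (code · oSucc m · n ⇒ ID oNat (oSucc m) n),
            λ c : code · m · n,
            ap · oNat · oNat · oConst cSucc · m · n · (r · n · c)) n)
      m).
Qed.

Definition ENCODE : oterm := Π m : oNat, Π n : oNat, ID oNat m n ⇒ code · m · n.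
Lemma encode_holds : holds ENCODE.
Proof.
  use_lemma code_refl_holds.
  by_term (λ r : CODE_REFL, λ m : oNat, λ n : oNat, λ p : ID oNat m n,
    encode oNat code r m n p).
Qed.

(** Applied to [A], this is the term [isSet A], which is a β-redex. *)
Definition is_set : oterm := λ A : oU 0, SET A.
Definition NAT_SET : oterm := is_set · oNat.
Lemma nat_set_holds : holds NAT_SET.
Proof.
  use_lemma set_criterion_holds. use_lemma code_prop_holds.
  use_lemma code_refl_holds. use_lemma decode_holds.
  by_term (λ d : DECODE, λ r : CODE_REFL, λ p : CODE_PROP, λ c : SET_CRITERION,
    c · oNat · code · p · r · d).
Qed.

Definition PI_PROP : oterm :=
  Π A : oU 0, Π B : (A ⇒ oU 0), (Π x : A, PROP (B · x)) ⇒ PROP (Π x : A, B · x).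
Lemma pi_prop_holds : holds PI_PROP.
Proof.
  use_lemma funext_holds.
  by_term (λ fe : FUNEXT, λ A : oU 0, λ B : (A ⇒ oU 0),
    λ h : (Π x : A, PROP (B · x)), λ f : (Π x : A, B · x), λ g : (Π x : A, B · x),
    fe · A · B · f · g · (λ x : A, h · x · (f · x) · (g · x))).
Qed.

Definition ARROW_SET : oterm :=
  Π A : oU 0, Π B : oU 0, is_set · B ⇒ is_set · (A ⇒ B).
Lemma arrow_set_holds : holds ARROW_SET.
Proof.
  use_lemma set_criterion_holds. use_lemma pi_prop_holds. use_lemma funext_holds.
  by_term (λ fe : FUNEXT, λ pp : PI_PROP, λ c : SET_CRITERION,
    λ A : oU 0, λ B : oU 0, λ h : is_set · B,
    c · (A ⇒ B) · (λ f : A ⇒ B, λ g : A ⇒ B, Π x : A, ID B (f · x) (g · x))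
      · (λ f : A ⇒ B, λ g : A ⇒ B,
           pp · A · (λ x : A, ID B (f · x) (g · x)) · (λ x : A, h · (f · x) · (g · x)))
      · (λ f : A ⇒ B, λ x : A, REFL B (f · x))
      · (λ f : A ⇒ B, λ g : A ⇒ B, fe · A · (λ _ : A, B) · f · g)).
Qed.

Definition SIGMA_PROP : oterm :=
  Π A : oU 0, Π B : (A ⇒ oU 0), (Π x : A, PROP (B · x)) ⇒
  (Π x : A, Π y : A, B · x ⇒ B · y ⇒ ID A x y) ⇒ PROP (SIG A B).
(** The path between the first components has to be generalized, by quantifying over
    the second components in the motive, before it is eliminated. *)
Lemma sigma_prop_holds : holds SIGMA_PROP.
Proof.
  use_lemma ap_holds.
  by_term (λ ap : AP, λ A : oU 0, λ B : (A ⇒ oU 0), λ h : (Π x : A, PROP (B · x)),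
    λ k : (Π x : A, Π y : A, B · x ⇒ B · y ⇒ ID A x y), λ s : SIG A B,
    split A B (λ s : SIG A B, Π t : SIG A B, ID (SIG A B) s t)
      (λ x : A, λ u : B · x, λ t : SIG A B,
         split A B (λ t : SIG A B, ID (SIG A B) (oPair 0 A B x u) t)
           (λ y : A, λ v : B · y,
              oJ 0 0 A
                (λ x : A, λ y : A, λ _ : ID A x y, Π u : B · x, Π v : B · y,
                   ID (SIG A B) (oPair 0 A B x u) (oPair 0 A B y v))
                (λ x : A, λ u : B · x, λ v : B · x,
                   ap · (B · x) · SIG A B · (λ u : B · x, oPair 0 A B x u) · u · v
                     · (h · x · u · v))
                x y (k · x · y · u · v) · u · v)
           t)
      s).
Qed.

Definition TIMES_PROP : oterm :=
  Π A : oU 0, Π B : oU 0, PROP A ⇒ PROP B ⇒ PROP (TIMES A B).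
Lemma times_prop_holds : holds TIMES_PROP.
Proof.
  use_lemma sigma_prop_holds.
  by_term (λ sp : SIGMA_PROP, λ A : oU 0, λ B : oU 0, λ h : PROP A, λ k : PROP B,
    sp · A · (λ _ : A, B) · (λ _ : A, k)
      · (λ x : A, λ y : A, λ _ : B, λ _ : B, h · x · y)).
Qed.

Definition PAIR_EQ : oterm :=
  Π A : oU 0, Π B : oU 0, Π s : TIMES A B, Π t : TIMES A B,
  ID A (fst A (λ _ : A, B) s) (fst A (λ _ : A, B) t) ⇒
  ID B (snd A (λ _ : A, B) s) (snd A (λ _ : A, B) t) ⇒ ID (TIMES A B) s t.
Lemma pair_eq_holds : holds PAIR_EQ.
Proof.
  by_term (λ A : oU 0, λ B : oU 0, λ s : TIMES A B,
    split A (λ _ : A, B)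
      (λ s : TIMES A B, Π t : TIMES A B,
        ID A (fst A (λ _ : A, B) s) (fst A (λ _ : A, B) t) ⇒
        ID B (snd A (λ _ : A, B) s) (snd A (λ _ : A, B) t) ⇒ ID (TIMES A B) s t)
      (λ a : A, λ b : B, λ t : TIMES A B,
        split A (λ _ : A, B)
        (λ t : TIMES A B,
          ID A a (fst A (λ _ : A, B) t) ⇒ ID B b (snd A (λ _ : A, B) t) ⇒
          ID (TIMES A B) (oPair 0 A (λ _ : A, B) a b) t)
        (λ a' : A, λ b' : B, λ p : ID A a a', λ q : ID B b b',
          oJ 0 0 A
            (λ a : A, λ a' : A, λ _ : ID A a a',
              ID (TIMES A B) (oPair 0 A (λ _ : A, B) a b) (oPair 0 A (λ _ : A, B) a' b'))
            (λ a : A, oJ 0 0 B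
              (λ b : B, λ b' : B, λ _ : ID B b b',
                ID (TIMES A B) (oPair 0 A (λ _ : A, B) a b) (oPair 0 A (λ _ : A, B) a b'))
              (λ b : B, REFL (TIMES A B) (oPair 0 A (λ _ : A, B) a b)) b b' q)
            a a' p)
        t)
      s).
Qed.

Definition TIMES_SET : oterm :=
  Π A : oU 0, Π B : oU 0, is_set · A ⇒ is_set · B ⇒ is_set · TIMES A B.
Lemma times_set_holds : holds TIMES_SET.
Proof.
  use_lemma set_criterion_holds. use_lemma times_prop_holds. use_lemma pair_eq_holds.
  by_term (λ pe : PAIR_EQ, λ tp : TIMES_PROP, λ c : SET_CRITERION,
    λ A : oU 0, λ B : oU 0, λ h : is_set · A, λ k : is_set · B,
    (* the projections are abstracted to keep the terms to be typed small *)
    (λ f : TIMES A B ⇒ A, λ g : TIMES A B ⇒ B,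
     λ pe : (Π s : TIMES A B, Π t : TIMES A B,
         ID A (f · s) (f · t) ⇒ ID B (g · s) (g · t) ⇒ ID (TIMES A B) s t),
     c · TIMES A B
      · (λ s : TIMES A B, λ t : TIMES A B,
           TIMES (ID A (f · s) (f · t)) (ID B (g · s) (g · t)))
      · (λ s : TIMES A B, λ t : TIMES A B,
           tp · ID A (f · s) (f · t) · ID B (g · s) (g · t)
             · (h · (f · s) · (f · t)) · (k · (g · s) · (g · t)))
      · (λ s : TIMES A B, oPair 0 (ID A (f · s) (f · s))
           (λ _ : ID A (f · s) (f · s), ID B (g · s) (g · s))
           (REFL A (f · s)) (REFL B (g · s)))
      · (λ s : TIMES A B, λ t : TIMES A B,
         λ r : TIMES (ID A (f · s) (f · t)) (ID B (g · s) (g · t)),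
           pe · s · t
            · fst (ID A (f · s) (f · t))
                (λ _ : ID A (f · s) (f · t), ID B (g · s) (g · t)) r
            · snd (ID A (f · s) (f · t))
                (λ _ : ID A (f · s) (f · t), ID B (g · s) (g · t)) r))
    · (λ s : TIMES A B, fst A (λ _ : A, B) s)
    · (λ s : TIMES A B, snd A (λ _ : A, B) s)
    · (pe · A · B)).
Qed.

(** * The logical rules and axioms inside HoTT *)

(** Applied to [A], this is the term [isProp A]. *)
Definition is_prop : oterm := λ A : oU 0, PROP A.

Definition EMPTY_E : oterm := Π A : oU 0, oEmpty ⇒ A.
Lemma empty_e_holds : holds EMPTY_E.
Proof. by_term (λ A : oU 0, λ e : oEmpty, oConst (cInd0 0) · (λ _ : oEmpty, A) · e). Qed.

Definition AND_E1 : oterm := Π A : oU 0, Π B : oU 0, TIMES A B ⇒ A.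
Lemma and_e1_holds : holds AND_E1.
Proof. by_term (λ A : oU 0, λ B : oU 0, λ s : TIMES A B, fst A (λ _ : A, B) s). Qed.

Definition AND_E2 : oterm := Π A : oU 0, Π B : oU 0, TIMES A B ⇒ B.
Lemma and_e2_holds : holds AND_E2.
Proof. by_term (λ A : oU 0, λ B : oU 0, λ s : TIMES A B, snd A (λ _ : A, B) s). Qed.

Definition AND_I : oterm := Π A : oU 0, Π B : oU 0, A ⇒ B ⇒ TIMES A B.
Lemma and_i_holds : holds AND_I.
Proof.
  by_term (λ A : oU 0, λ B : oU 0, λ a : A, λ b : B, oPair 0 A (λ _ : A, B) a b).
Qed.

Definition OR_I1 : oterm := Π A : oU 0, Π B : oU 0, A ⇒ TRUNC (oSum 0 A B).
Lemma or_i1_holds : holds OR_I1.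
Proof. by_term (λ A : oU 0, λ B : oU 0, λ a : A, oTr 0 (oSum 0 A B) (oInl 0 A B a)). Qed.

Definition OR_I2 : oterm := Π A : oU 0, Π B : oU 0, B ⇒ TRUNC (oSum 0 A B).
Lemma or_i2_holds : holds OR_I2.
Proof. by_term (λ A : oU 0, λ B : oU 0, λ b : B, oTr 0 (oSum 0 A B) (oInr 0 A B b)). Qed.

Definition OR_E : oterm :=
  Π A : oU 0, Π B : oU 0, Π C : oU 0, is_prop · C ⇒
  TRUNC (oSum 0 A B) ⇒ (A ⇒ C) ⇒ (B ⇒ C) ⇒ C.
Lemma or_e_holds : holds OR_E.
Proof.
  by_term (λ A : oU 0, λ B : oU 0, λ C : oU 0, λ h : is_prop · C,
    λ x : TRUNC (oSum 0 A B), λ f : A ⇒ C, λ g : B ⇒ C,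
    trunc_rec (oSum 0 A B) C h
     (λ s : oSum 0 A B, oConst (cCase 0 0) · A · B · (λ _ : oSum 0 A B, C)
        · f · g · s) x).
Qed.

Definition EX_I : oterm :=
  Π A : oU 0, Π P : (A ⇒ oU 0), Π x : A, P · x ⇒ TRUNC (SIG A P).
Lemma ex_i_holds : holds EX_I.
Proof.
  by_term (λ A : oU 0, λ P : (A ⇒ oU 0), λ x : A, λ u : P · x,
    oTr 0 (SIG A P) (oPair 0 A P x u)).
Qed.

Definition EX_E : oterm :=
  Π A : oU 0, Π P : (A ⇒ oU 0), Π C : oU 0, is_prop · C ⇒ TRUNC (SIG A P) ⇒
  (Π x : A, P · x ⇒ C) ⇒ C.
Lemma ex_e_holds : holds EX_E.
Proof.
  by_term (λ A : oU 0, λ P : (A ⇒ oU 0), λ C : oU 0, λ h : is_prop · C,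
    λ t : TRUNC (SIG A P), λ f : (Π x : A, P · x ⇒ C),
    trunc_rec (SIG A P) C h
     (λ s : SIG A P, split A P (λ _ : SIG A P, C) f s) t).
Qed.

Definition SYM : oterm := Π A : oU 0, Π x : A, Π y : A, ID A x y ⇒ ID A y x.
Lemma sym_holds : holds SYM.
Proof. by_term (λ A : oU 0, λ x : A, λ y : A, λ p : ID A x y, sym A x y p). Qed.

Definition TRANS : oterm := Π A : oU 0, Π x : A, Π y : A, Π z : A,
  ID A x y ⇒ ID A y z ⇒ ID A x z.
Lemma trans_holds : holds TRANS.
Proof.
  by_term (λ A : oU 0, λ x : A, λ y : A, λ z : A, λ p : ID A x y, λ q : ID A y z,
    trans A x y z p q).
Qed.

Definition CONG : oterm := Π A : oU 0, Π B : oU 0, Π f : (A ⇒ B), Π g : (A ⇒ B),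
  Π x : A, Π y : A, ID (A ⇒ B) f g ⇒ ID A x y ⇒ ID B (f · x) (g · y).
Lemma cong_holds : holds CONG.
Proof.
  use_lemma ap_holds.
  by_term (λ ap : AP, λ A : oU 0, λ B : oU 0, λ f : (A ⇒ B), λ g : (A ⇒ B),
    λ x : A, λ y : A, λ p : ID (A ⇒ B) f g, λ q : ID A x y,
    trans B (f · x) (g · x) (g · y)
     (ap · (A ⇒ B) · B · (λ f : A ⇒ B, f · x) · f · g · p)
     (ap · A · B · g · x · y · q)).
Qed.

Definition REPL : oterm := Π A : oU 0, Π P : (A ⇒ oU 0), Π x : A, Π y : A,
  ID A x y ⇒ P · x ⇒ P · y.
Lemma repl_holds : holds REPL.
Proof.
  by_term (λ A : oU 0, λ P : (A ⇒ oU 0), λ x : A, λ y : A, λ p : ID A x y,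
    λ u : P · x, transport A P x y p u).
Qed.

Definition ZERO_SUCC : oterm := Π n : oNat, ID oNat (oSucc n) oZero ⇒ oEmpty.
Lemma zero_succ_holds : holds ZERO_SUCC.
Proof.
  use_lemma encode_holds.
  by_term (λ e : ENCODE, λ n : oNat, λ p : ID oNat (oSucc n) oZero,
    e · oSucc n · oZero · p).
Qed.

Definition SUCC_INJ : oterm := Π m : oNat, Π n : oNat,
  ID oNat (oSucc m) (oSucc n) ⇒ ID oNat m n.
(** The codes of [S m = S n] and of [m = n] are definitionally equal. *)
Lemma succ_inj_holds : holds SUCC_INJ.
Proof.
  use_lemma encode_holds. use_lemma decode_holds.
  by_term (λ d : DECODE, λ e : ENCODE, λ m : oNat, λ n : oNat,
    λ p : ID oNat (oSucc m) (oSucc n), d · m · n · (e · oSucc m · oSucc n · p)).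
Qed.

Definition ID_ISPROP : oterm := Π A : oU 0, is_set · A ⇒
  Π x : A, Π y : A, is_prop · ID A x y.
Lemma id_isprop_holds : holds ID_ISPROP.
Proof. by_term (λ A : oU 0, λ h : is_set · A, h). Qed.

Definition EMPTY_ISPROP : oterm := is_prop · oEmpty.
Lemma empty_isprop_holds : holds EMPTY_ISPROP.
Proof. use_lemma empty_prop_holds. by_term (λ h : EMPTY_PROP, h). Qed.

Definition TRUNC_ISPROP : oterm := Π A : oU 0, is_prop · TRUNC A.
Lemma trunc_isprop_holds : holds TRUNC_ISPROP.
Proof. by_term (oConst (cTrPath 0)). Qed.

Definition TIMES_ISPROP : oterm := Π A : oU 0, Π B : oU 0,
  is_prop · A ⇒ is_prop · B ⇒ is_prop · TIMES A B.
Lemma times_isprop_holds : holds TIMES_ISPROP.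
Proof. use_lemma times_prop_holds. by_term (λ h : TIMES_PROP, h). Qed.

Definition PI_ISPROP : oterm := Π A : oU 0, Π B : (A ⇒ oU 0),
  (Π x : A, is_prop · (B · x)) ⇒ is_prop · (Π x : A, B · x).
Lemma pi_isprop_holds : holds PI_ISPROP.
Proof. use_lemma pi_prop_holds. by_term (λ h : PI_PROP, h). Qed.

(** The conclusion is stated by elimination into an arbitrary small type, which spares
    its users a dependent pair of a function and a proof. *)
Definition UNIQUE_CHOICE : oterm :=
  Π A : oU 0, Π B : oU 0, Π Q : (A ⇒ B ⇒ oU 0),
  (Π x : A, Π y : B, is_prop · (Q · x · y)) ⇒
  (Π x : A, TRUNC (SIG B (Q · x))) ⇒
  (Π x : A, Π y : B, Π z : B, Q · x · y ⇒ Q · x · z ⇒ ID B y z) ⇒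
  Π C : oU 0, (Π f : (A ⇒ B), (Π x : A, Q · x · (f · x)) ⇒ C) ⇒ C.
Lemma unique_choice_holds : holds UNIQUE_CHOICE.
Proof.
  use_lemma sigma_prop_holds.
  by_term (λ sp : SIGMA_PROP, λ A : oU 0, λ B : oU 0, λ Q : (A ⇒ B ⇒ oU 0),
    λ h : (Π x : A, Π y : B, is_prop · (Q · x · y)),
    λ e : (Π x : A, TRUNC (SIG B (Q · x))),
    λ u : (Π x : A, Π y : B, Π z : B, Q · x · y ⇒ Q · x · z ⇒ ID B y z),
    λ C : oU 0, λ k : (Π f : (A ⇒ B), (Π x : A, Q · x · (f · x)) ⇒ C),
    (λ c : (Π x : A, SIG B (Q · x)),
     k · (λ x : A, fst B (Q · x) (c · x)) · (λ x : A, snd B (Q · x) (c · x)))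
    · (λ x : A, trunc_rec (SIG B (Q · x)) (SIG B (Q · x))
        (sp · B · (Q · x) · (h · x) · (u · x))
        (λ s : SIG B (Q · x), s) (e · x))).
Qed.

(** The translations of the constants of the arithmetic, with arbitrary small types in
    place of the translations of finite types; the equations below are instantiated
    with the latter. *)
Definition rec_term (A : oterm) : oterm :=
  λ a : A, λ b : (A ⇒ oNat ⇒ A), λ n : oNat,
          oConst (cNatInd 0) · (λ _ : oNat, A) · a
            · (λ m : oNat, λ r : A, b · r · m) · n.
Definition pair_term (A B : oterm) : oterm :=
  λ a : A, λ b : B, oPair 0 A (λ _ : A, B) a b.
Definition proj1_term (A B : oterm) : oterm :=
          λ c : oTimes 0 A B,
          oConst (cSplit 0 0) · A · (λ _ : A, B) · (λ _ : oTimes 0 A B, A)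
            · (λ a : A, λ b : B, a) · c.
Definition proj2_term (A B : oterm) : oterm :=
          λ c : oTimes 0 A B,
          oConst (cSplit 0 0) · A · (λ _ : A, B) · (λ _ : oTimes 0 A B, B)
            · (λ a : A, λ b : B, b) · c.
Definition k_term (A B : oterm) : oterm := λ a : A, λ b : B, a.
Definition s_term (A B C : oterm) : oterm :=
   λ x : (A ⇒ B ⇒ C), λ y : (A ⇒ B), λ z : A, x · z · (y · z).

Definition REC_ZERO : oterm := Π A : oU 0, Π a : A, Π b : (A ⇒ oNat ⇒ A),
  ID A (rec_term A · a · b · oZero) a.
Lemma rec_zero_holds : holds REC_ZERO.
Proof. by_term (λ A : oU 0, λ a : A, λ b : (A ⇒ oNat ⇒ A), REFL A a). Qed.

Definition REC_SUCC : oterm := Π A : oU 0, Π a : A, Π b : (A ⇒ oNat ⇒ A), Π n : oNat,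
  ID A (rec_term A · a · b · (oConst cSucc · n)) (b · (rec_term A · a · b · n) · n).
Lemma rec_succ_holds : holds REC_SUCC.
Proof.
  by_term (λ A : oU 0, λ a : A, λ b : (A ⇒ oNat ⇒ A), λ n : oNat,
    REFL A (b · (rec_term A · a · b · n) · n)).
Qed.

Definition PROJ1_PAIR : oterm := Π A : oU 0, Π B : oU 0, Π a : A, Π b : B,
  ID A (proj1_term A B · (pair_term A B · a · b)) a.
Lemma proj1_pair_holds : holds PROJ1_PAIR.
Proof. by_term (λ A : oU 0, λ B : oU 0, λ a : A, λ b : B, REFL A a). Qed.

Definition PROJ2_PAIR : oterm := Π A : oU 0, Π B : oU 0, Π a : A, Π b : B,
  ID B (proj2_term A B · (pair_term A B · a · b)) b.
Lemma proj2_pair_holds : holds PROJ2_PAIR.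
Proof. by_term (λ A : oU 0, λ B : oU 0, λ a : A, λ b : B, REFL B b). Qed.

Definition SURJ_PAIR : oterm := Π A : oU 0, Π B : oU 0, Π c : TIMES A B,
  ID (TIMES A B) (pair_term A B · (proj1_term A B · c) · (proj2_term A B · c)) c.
Lemma surj_pair_holds : holds SURJ_PAIR.
Proof.
  by_term (λ A : oU 0, λ B : oU 0, λ c : TIMES A B,
    split A (λ _ : A, B)
     (λ c : TIMES A B, ID (TIMES A B)
        (pair_term A B · (proj1_term A B · c) · (proj2_term A B · c)) c)
     (λ a : A, λ b : B, REFL (TIMES A B) (oPair 0 A (λ _ : A, B) a b)) c).
Qed.

Definition K_EQ : oterm := Π A : oU 0, Π B : oU 0, Π a : A, Π b : B,
  ID A (k_term A B · a · b) a.
Lemma k_eq_holds : holds K_EQ.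
Proof. by_term (λ A : oU 0, λ B : oU 0, λ a : A, λ b : B, REFL A a). Qed.

Definition S_EQ : oterm := Π A : oU 0, Π B : oU 0, Π C : oU 0,
  Π a : (A ⇒ B ⇒ C), Π b : (A ⇒ B), Π c : A,
  ID C (s_term A B C · a · b · c) (a · c · (b · c)).
Lemma s_eq_holds : holds S_EQ.
Proof.
  by_term (λ A : oU 0, λ B : oU 0, λ C : oU 0,
   λ a : (A ⇒ B ⇒ C), λ b : (A ⇒ B), λ c : A, REFL C (a · c · (b · c))).
Qed.

(** * The translation commutes with renaming and substitution *)

Lemma ftype_closed s σ : sub s (ftype_star σ) = ftype_star σ.
Proof.
  revert s; induction σ; intros s; simpl; auto.
  - unfold arr; simpl. now rewrite IHσ1, up_shift, IHσ2.
  - unfold times, Sig; simpl. now rewrite IHσ1, up_shift, IHσ2.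
Qed.

Lemma ren_ftype r σ : ren r (ftype_star σ) = ftype_star σ.
Proof. rewrite ren_as_sub; apply ftype_closed. Qed.

Lemma shift_ftype k σ : shift k (ftype_star σ) = ftype_star σ.
Proof. apply ren_ftype. Qed.

Lemma arr_star σ τ : ftype_star (Arr σ τ) = Pi (ftype_star σ) (ftype_star τ).
Proof. simpl; unfold arr; now rewrite shift_ftype. Qed.

Lemma prod_star σ τ : ftype_star (Prod σ τ) =
  App (App (Const (cSig 0)) (ftype_star σ)) (Lam (ftype_star σ) (ftype_star τ)).
Proof. simpl; unfold times, Sig; now rewrite shift_ftype. Qed.

Definition star_subst {Γ Δ} (s : HA.subst Γ Δ) (s' : nat -> tm) : Prop :=
  forall σ (v : HA.var Γ σ), s' (var_star v) = tm_star (s σ v).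

Lemma const_star_closed {σ} (c : HA.const σ) s : sub s (const_star c) = const_star c.
Proof.
  destruct c; try reflexivity; cbn; unfold o_ftype; rewrite !ftype_closed; reflexivity.
Qed.

Lemma tm_star_ren {Γ Δ} (r : HA.renaming Γ Δ) r' {σ} (t : HA.tm Γ σ) :
  (forall τ (v : HA.var Γ τ), r' (var_star v) = var_star (r τ v)) ->
  tm_star (HA.ren_tm r t) = ren r' (tm_star t).
Proof.
  intros H; induction t; simpl; f_equal; auto.
  rewrite ren_as_sub; now rewrite const_star_closed.
Qed.

Lemma tm_star_wk {Γ τ σ} (t : HA.tm Γ σ) :
  tm_star (@HA.wk_tm Γ τ σ t) = shift 1 (tm_star t).
Proof. apply tm_star_ren; reflexivity. Qed.

Lemma tm_star_sub {Γ Δ} (s : HA.subst Γ Δ) s' {σ} (t : HA.tm Γ σ) :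
  star_subst s s' -> tm_star (HA.sub_tm s t) = sub s' (tm_star t).
Proof.
  intros H; induction t; simpl; f_equal; auto. now rewrite const_star_closed.
Qed.

Lemma var_cons_inv {Γ τ} (P : forall σ, HA.var (τ :: Γ) σ -> Prop) :
  P τ HA.vz -> (forall σ v, P σ (HA.vs v)) -> forall σ v, P σ v.
Proof.
  intros Hz Hs σ v.
  refine (match v as v' in HA.var Γ' σ' return
    match Γ' return HA.var Γ' σ' -> Prop with
    | [] => fun _ => True
    | τ' :: Γ0 => fun v => forall P : (forall σ, HA.var (τ' :: Γ0) σ -> Prop),
       P τ' HA.vz -> (forall σ v, P σ (HA.vs v)) -> P σ' v
    end v' with
    | HA.vz => fun P Hz _ => Hz
    | HA.vs w => fun P _ Hs => Hs _ w
    end P Hz Hs).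
Qed.

Lemma star_subst_scons {Γ Δ τ} (t : HA.tm Δ τ) (s : HA.subst Γ Δ) s' :
  star_subst s s' -> star_subst (HA.scons t s) (scons (tm_star t) s').
Proof. intros H; refine (var_cons_inv _ _ _); simpl; auto. Qed.

Lemma star_subst_up {Γ Δ τ} (s : HA.subst Γ Δ) s' :
  star_subst s s' -> star_subst (HA.up (τ := τ) s) (up s').
Proof.
  intros H; refine (var_cons_inv _ _ _); simpl; auto.
  intros σ v. now rewrite tm_star_wk, H.
Qed.

Lemma form_star_ren {Γ} (φ : HA.form Γ) : forall Δ (r : HA.renaming Γ Δ) r',
  (forall τ (v : HA.var Γ τ), r' (var_star v) = var_star (r τ v)) ->
  form_star (HA.ren r φ) = ren r' (form_star φ).
Proof.
  assert (Hup : forall Γ Δ τ (r : HA.renaming Γ Δ) r',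
    (forall τ (v : HA.var Γ τ), r' (var_star v) = var_star (r τ v)) ->
    forall σ (v : HA.var (τ :: Γ) σ),
      up_ren r' (var_star v) = var_star (HA.up_ren r σ v)).
  { intros Γ0 Δ τ r r' H; refine (var_cons_inv _ _ _); simpl; auto. }
  induction φ as [Γ τ t u|Γ|Γ φ IH ψ IH'|Γ φ IH ψ IH'|Γ φ IH ψ IH'|Γ τ φ IH|Γ τ φ IH];
    intros Δ r r' H; simpl; unfold times, arr, Sig, Trunc, Sum, Id; simpl;
    rewrite ?ren_up_shift, ?ren_ftype; repeat f_equal; auto; now apply tm_star_ren.
Qed.

Lemma form_star_wk {Γ τ} (φ : HA.form Γ) :
  form_star (@HA.wk Γ τ φ) = shift 1 (form_star φ).
Proof. apply form_star_ren; reflexivity. Qed.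

Lemma form_star_sub {Γ} (φ : HA.form Γ) : forall Δ (s : HA.subst Γ Δ) s',
  star_subst s s' -> form_star (HA.sub s φ) = sub s' (form_star φ).
Proof.
  induction φ as [Γ τ t u|Γ|Γ φ IH ψ IH'|Γ φ IH ψ IH'|Γ φ IH ψ IH'|Γ τ φ IH|Γ τ φ IH];
    intros Δ s s' H; simpl; unfold times, arr, Sig, Trunc, Sum, Id; simpl;
    rewrite ?up_shift, ?ftype_closed; repeat f_equal; auto using star_subst_up;
    now apply tm_star_sub.
Qed.

Lemma sub_form_sub {Γ Γ'} s s' (φ : HA.form Γ) (r : HA.subst Γ Γ') t :
  star_subst r t -> (forall n, sub s (t n) = s' n) ->
  sub s (form_star (HA.sub r φ)) = sub s' (form_star φ).
Proof.
  intros Hr E. rewrite (form_star_sub φ _ r t Hr), sub_sub. now apply sub_ext.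
Qed.

(** * Instances of facts *)

(** The typing of the application of [t] to [args], as a statement that unfolds by
    computation. The arguments are substituted all at once, so the types of the facts
    below are instantiated without iterated instances. *)
Fixpoint typed_instance Γ (s : nat -> tm) (t T : tm) (args : list tm)
  {struct args} : Prop :=
  match args, T with
  | [], _ => has_type Γ t (sub s T)
  | a :: args, Pi A B =>
      has_type Γ a (sub s A) -> typed_instance Γ (scons a s) (App t a) B args
  | _, _ => True
  end.

Lemma typed_instance_intro Γ args : forall s t T,
  has_type Γ t (sub s T) -> typed_instance Γ s t T args.
Proof.
  induction args as [|a args IH]; intros s t T Ht; simpl; auto.
  destruct T; try exact I. intros Ha. apply IH. rewrite <- inst_up. eapply ty_app; eauto.
Qed.

Lemma const_instance Γ c args : wf Γ ->
  typed_instance Γ Var (Const c) (close (const_type c)) args.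
Proof.
  intros W; apply typed_instance_intro. rewrite const_type_closed. now apply ty_const.
Qed.

Fixpoint instance Γ (s : nat -> tm) (T : tm) (args : list tm) {struct args} : Prop :=
  match args, T with
  | [], _ => inhabited Γ (sub s T)
  | a :: args, Pi A B =>
      has_type Γ a (sub s A) -> instance Γ (scons a s) B args
  | _, _ => True
  end.

Lemma instance_intro Γ args : forall s T,
  inhabited Γ (sub s T) -> instance Γ s T args.
Proof.
  induction args as [|a args IH]; intros s T [t Ht]; simpl; [now exists t|].
  destruct T; try exact I. intros Ha. apply IH. exists (App t a).
  rewrite <- inst_up. eapply ty_app; eauto.
Qed.

Lemma holds_instance T Γ args : holds T -> wf Γ -> instance Γ Var (close T) args.
Proof.
  intros [t Ht] W; apply instance_intro. exists (sub Var t).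
  apply (has_type_sub [] _ _ _ _ Ht); auto using sub_ok_nil.
Qed.

Lemma times_sub s A B : sub s (times A B) = times (sub s A) (sub s B).
Proof. unfold times, Sig; simpl; now rewrite up_shift. Qed.

Lemma arr_sub s A B : sub s (arr A B) = arr (sub s A) (sub s B).
Proof. unfold arr; simpl; now rewrite up_shift. Qed.

Lemma inh_app Γ A B : inhabited Γ (arr A B) -> inhabited Γ A -> inhabited Γ B.
Proof.
  intros [f Hf] [a Ha]. exists (App f a).
  rewrite <- (inst_shift B a). eapply ty_app; eauto.
Qed.

Lemma inh_pi Γ A B : inhabited (A :: Γ) B -> inhabited Γ (Pi A B).
Proof. intros [b Hb]; exists (Lam A b); now apply ty_lam. Qed.

Lemma inh_conv Γ A B i : inhabited Γ A -> def_eq Γ A B (U i) -> inhabited Γ B.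
Proof. intros [a Ha] E; exists a; eapply ty_conv; eauto. Qed.

Lemma inh_wk Γ A B : wf (B :: Γ) -> inhabited Γ A -> inhabited (B :: Γ) (shift 1 A).
Proof. intros W [a Ha]; exists (shift 1 a); now apply has_type_wk. Qed.

(** * The translations of finite types, terms and formulas are typed *)

Lemma ftype_star_type Γ σ : wf Γ -> has_type Γ (ftype_star σ) (U 0).
Proof.
  intros W.
  assert (H : has_type [] (ftype_star σ) (U 0)).
  { clear; induction σ; simpl.
    - exact (ty_const [] cNat wf_nil).
    - apply ty_pi; auto. apply (has_type_wk _ _ (U 0)); eauto using wf_cons.
    - apply (const_instance [] (cSig 0) [_; _] wf_nil); simpl; auto.
      apply ty_lam. apply (has_type_wk _ _ (U 0)); eauto using wf_cons. }
  rewrite <- (ftype_closed Var). now apply (has_type_sub [] _ (U 0) _ _ H W), sub_ok_nil.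
Qed.

Lemma ctx_star_wf Γ : wf (ctx_star Γ).
Proof.
  induction Γ as [|σ Γ IH]; simpl; [apply wf_nil|].
  eapply wf_cons, ftype_star_type, IH.
Qed.

Lemma var_star_type {Γ σ} (v : HA.var Γ σ) :
  has_type (ctx_star Γ) (Var (var_star v)) (ftype_star σ).
Proof.
  rewrite <- (shift_ftype (S (var_star v)) σ). apply ty_var; [apply ctx_star_wf|].
  induction v; simpl; auto.
Qed.

Lemma sub_ok_ftypes Γ l : wf Γ -> Forall (fun a => has_type Γ a (U 0)) l ->
  sub_ok (map (fun _ => U 0) l) Γ (list_subst l).
Proof.
  intros W; induction 1; simpl; [apply sub_ok_nil | now apply sub_ok_scons].
Qed.

Lemma const_star_type {σ} (c : HA.const σ) Γ : wf Γ ->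
  has_type Γ (const_star c) (ftype_star σ).
Proof.
  intros W. rewrite <- (const_star_closed c Var), <- (ftype_closed Var σ).
  apply (has_type_sub []); auto using sub_ok_nil. clear Γ W.
  (* the terms are checked with type variables for the finite types *)
  assert (open : forall l t T, typechecks rules (map (fun _ => U 0) l) t T = true ->
     has_type [] (sub (list_subst (map ftype_star l)) t)
                 (sub (list_subst (map ftype_star l)) T)).
  { intros l t T H. apply (has_type_sub (map (fun _ => U 0) (map ftype_star l))).
    - rewrite map_map. apply (typechecks_sound rules); auto using rules_valid.
      clear; induction l; simpl; [apply wf_nil | eapply wf_cons, ty_univ; auto].
    - apply wf_nil.
    - apply sub_ok_ftypes; [apply wf_nil|]. clear; induction l; simpl; constructor; auto.
      apply ftype_star_type, wf_nil. }
  pose (v n := (fun d => Var (d + n)) : oterm).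
  destruct c; rewrite ?arr_star, ?prod_star.
  - exact (ty_const [] cZero wf_nil).
  - exact (ty_const [] cSucc wf_nil).
  - pose proof (open [σ] (rec_term (v 0) 0)
      ((v 0 ⇒ (v 0 ⇒ oNat ⇒ v 0) ⇒ oNat ⇒ v 0)%oterm 0)
      ltac:(vm_compute; reflexivity)) as H.
    cbn in H; rewrite ?ren_ftype in H; exact H.
  - pose proof (open [τ; σ] (pair_term (v 1) (v 0) 0)
      ((v 1 ⇒ v 0 ⇒ oTimes 0 (v 1) (v 0))%oterm 0)
      ltac:(vm_compute; reflexivity)) as H.
    cbn in H; rewrite ?ren_ftype in H; exact H.
  - pose proof (open [τ; σ] (proj1_term (v 1) (v 0) 0)
      ((oTimes 0 (v 1) (v 0) ⇒ v 1)%oterm 0)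
      ltac:(vm_compute; reflexivity)) as H.
    cbn in H; rewrite ?ren_ftype in H; exact H.
  - pose proof (open [τ; σ] (proj2_term (v 1) (v 0) 0)
      ((oTimes 0 (v 1) (v 0) ⇒ v 0)%oterm 0)
      ltac:(vm_compute; reflexivity)) as H.
    cbn in H; rewrite ?ren_ftype in H; exact H.
  - pose proof (open [τ; σ] (k_term (v 1) (v 0) 0)
      ((v 1 ⇒ v 0 ⇒ v 1)%oterm 0)
      ltac:(vm_compute; reflexivity)) as H.
    cbn in H; rewrite ?ren_ftype in H; exact H.
  - pose proof (open [τ; σ; ρ] (s_term (v 2) (v 1) (v 0) 0)
      (((v 2 ⇒ v 1 ⇒ v 0) ⇒ (v 2 ⇒ v 1) ⇒ v 2 ⇒ v 0)%oterm 0)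
      ltac:(vm_compute; reflexivity)) as H.
    cbn in H; rewrite ?ren_ftype in H; exact H.
Qed.

Lemma tm_star_type Γ σ (t : HA.tm Γ σ) :
  has_type (ctx_star Γ) (tm_star t) (ftype_star σ).
Proof.
  induction t; simpl.
  - apply var_star_type.
  - apply const_star_type, ctx_star_wf.
  - rewrite <- (inst_shift (ftype_star τ) (tm_star t2)).
    eapply ty_app; [exact IHt1 | exact IHt2].
Qed.

Lemma form_star_type Γ (φ : HA.form Γ) : has_type (ctx_star Γ) (form_star φ) (U 0).
Proof.
  induction φ as [Γ τ t u|Γ|Γ φ IH ψ IH'|Γ φ IH ψ IH'|Γ φ IH ψ IH'|Γ τ φ IH|Γ τ φ IH];
    simpl; pose proof (ctx_star_wf Γ) as W.
  - apply (const_instance _ (cId 0) [_; _; _] W); simpl;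
      auto using tm_star_type, ftype_star_type.
  - now apply (ty_const _ cEmpty).
  - apply (const_instance _ (cSig 0) [_; _] W); simpl; auto.
    apply ty_lam. apply (has_type_wk _ _ (U 0)); eauto using wf_cons.
  - apply (const_instance _ (cTrunc 0) [_] W); simpl.
    apply (const_instance _ (cSum 0) [_; _] W); simpl; auto.
  - apply ty_pi; auto. apply (has_type_wk _ _ (U 0)); eauto using wf_cons.
  - apply ty_pi; auto using ftype_star_type.
  - apply (const_instance _ (cTrunc 0) [_] W); simpl.
    apply (const_instance _ (cSig 0) [_; _] W); simpl; auto using ftype_star_type.
    now apply ty_lam.
Qed.

(** * The translations are h-sets and h-propositions *)

(** The proofs for the type formers are closed terms that take the types and the proofs
    for their components as arguments, so [p] is a plain recursion. *)
Lemma ftype_isSet : exists p : ftype -> tm,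
  forall σ, has_type [] (p σ) (isSet (ftype_star σ)).
Proof.
  destruct nat_set_holds as [pN HN], arrow_set_holds as [pA HA],
    times_set_holds as [pT HT].
  exists (fix p σ :=
    match σ with
    | N => pN
    | Arr σ τ => App (App (App pA (ftype_star σ)) (ftype_star τ)) (p τ)
    | Prod σ τ =>
        App (App (App (App pT (ftype_star σ)) (ftype_star τ)) (p σ)) (p τ)
    end).
  induction σ as [|σ IHσ τ IHτ|σ IHσ τ IHτ]; [exact HN | |].
  - apply (typed_instance_intro [] [_; _; _] Var pA (close ARROW_SET) HA);
      auto using ftype_star_type, wf_nil.
  - apply (typed_instance_intro [] [_; _; _; _] Var pT (close TIMES_SET) HT);
      auto using ftype_star_type, wf_nil.
Qed.

Lemma inh_pi_inv Γ A B : wf (A :: Γ) -> inhabited Γ (Pi A B) -> inhabited (A :: Γ) B.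
Proof.
  intros W [f Hf]. exists (App (shift 1 f) (Var 0)).
  replace B with (inst (sub (up (wk_sub Var)) B) (Var 0)) at 1.
  - eapply ty_app.
    + pose proof (has_type_wk _ _ _ _ W Hf) as H.
      rewrite (shift_wk_sub (Pi A B)) in H. exact H.
    + rewrite <- shift_wk_sub. now apply (ty_var _ 0).
  - rewrite inst_up. apply sub_id; intros [|n]; reflexivity.
Qed.

Lemma isProp_cong Γ A B : wf Γ -> def_eq Γ A B (U 0) ->
  def_eq Γ (isProp A) (isProp B) (U 0).
Proof.
  intros W E. apply (eq_app _ (U 0) (U 0)); auto. apply eq_refl.
  apply (has_type_sub [] (close is_prop) (Pi (U 0) (U 0)) Γ Var); auto using sub_ok_nil.
  apply (typechecks_sound rules); [exact rules_valid | apply wf_nil | vm_compute; reflexivity].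
Qed.

(** The fact for families [P : A ⇒ U] is applied to [λ A, B]; the instances of this
    family are then β-reduced under [Π] and under [isProp]. *)
Lemma inh_isProp_pi Γ A B : wf Γ -> has_type Γ A (U 0) -> has_type (A :: Γ) B (U 0) ->
  inhabited (A :: Γ) (isProp B) -> inhabited Γ (isProp (Pi A B)).
Proof.
  intros W HA HB H. assert (W' := wf_cons _ _ _ HA).
  assert (E := beta_var Γ A B (U 0) 0 W HA HB).
  assert (K : inhabited Γ (Pi A (isProp (App (shift 1 (Lam A B)) (Var 0))))).
  { apply inh_pi. eapply inh_conv; [exact H|]. apply isProp_cong; auto.
    apply eq_sym, E. }
  destruct K as [h Hh].
  eapply inh_conv; [|apply isProp_cong; [exact W|];
    apply eq_pi; [exact HA | apply eq_refl, HA | exact E]].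
  apply (holds_instance PI_ISPROP _ [A; Lam A B; h] pi_isprop_holds W); auto.
  now apply ty_lam.
Qed.

Lemma form_isProp Γ (φ : HA.form Γ) : inhabited (ctx_star Γ) (isProp (form_star φ)).
Proof.
  induction φ as [Γ τ t u|Γ|Γ φ IH ψ IH'|Γ φ IH ψ IH'|Γ φ IH ψ IH'|Γ τ φ IH|Γ τ φ IH];
    pose proof (ctx_star_wf Γ) as W; simpl.
  - destruct ftype_isSet as [p Hp]. specialize (Hp τ).
    apply (has_type_sub _ _ _ (ctx_star Γ) Var) in Hp; [| exact W | apply sub_ok_nil].
    cbn in Hp. rewrite ftype_closed in Hp.
    apply (holds_instance ID_ISPROP _ [_; sub Var (p τ); _; _] id_isprop_holds W);
      auto using ftype_star_type, tm_star_type.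
  - exact (holds_instance EMPTY_ISPROP _ [] empty_isprop_holds W).
  - destruct IH as [a Ha], IH' as [b Hb].
    apply (holds_instance TIMES_ISPROP _ [_; _; a; b] times_isprop_holds W);
      auto using form_star_type.
  - apply (holds_instance TRUNC_ISPROP _ [_] trunc_isprop_holds W).
    apply (const_instance _ (cSum 0) [_; _] W); simpl; auto using form_star_type.
  - assert (W' := wf_cons _ _ _ (form_star_type Γ φ)).
    apply inh_isProp_pi; auto using form_star_type.
    + apply (has_type_wk _ _ (U 0)); auto using form_star_type.
    + apply (inh_wk _ (isProp (form_star ψ))); auto.
  - apply inh_isProp_pi; auto using ftype_star_type. apply (form_star_type (_ :: _)).
  - apply (holds_instance TRUNC_ISPROP _ [_] trunc_isprop_holds W).
    apply (const_instance _ (cSig 0) [_; _] W); simpl; auto using ftype_star_type.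
    apply ty_lam, (form_star_type (_ :: _)).
Qed.

(** * Forcing *)

Definition world Γ Δ s : Prop := wf Δ /\ sub_ok (ctx_star Γ) Δ s.
Definition forces {Γ} Δ s (φ : HA.form Γ) : Prop :=
  inhabited Δ (sub s (form_star φ)).

Lemma world_wk Γ Δ s A i : world Γ Δ s -> has_type Δ A (U i) ->
  world Γ (A :: Δ) (wk_sub s).
Proof. intros [W H] HA. assert (W' := wf_cons _ _ _ HA). split; auto using sub_ok_wk. Qed.

Lemma world_cons Γ Δ s σ a : world Γ Δ s -> has_type Δ a (ftype_star σ) ->
  world (σ :: Γ) Δ (scons a s).
Proof. intros [W H] Ha; split; auto. apply sub_ok_scons; auto. now rewrite ftype_closed. Qed.

Lemma world_up Γ Δ s σ : world Γ Δ s -> world (σ :: Γ) (ftype_star σ :: Δ) (up s).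
Proof.
  intros [W H]. assert (Hσ := ftype_star_type Δ σ W). split; [exact (wf_cons _ _ _ Hσ)|].
  pose proof (sub_ok_up (ctx_star Γ) Δ s (ftype_star σ) 0) as K.
  rewrite ftype_closed in K. now apply K.
Qed.

Lemma world_term Γ Δ s σ (t : HA.tm Γ σ) : world Γ Δ s ->
  has_type Δ (sub s (tm_star t)) (ftype_star σ).
Proof.
  intros [W H]. rewrite <- (ftype_closed s).
  eapply has_type_sub; eauto using tm_star_type.
Qed.

Lemma world_form Γ Δ s (φ : HA.form Γ) : world Γ Δ s ->
  has_type Δ (sub s (form_star φ)) (U 0).
Proof. intros [W H]. apply (has_type_sub _ _ _ _ _ (form_star_type Γ φ) W H). Qed.

Lemma world_ftype Γ Δ s σ : world Γ Δ s -> has_type Δ (sub s (ftype_star σ)) (U 0).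
Proof. intros [W _]. rewrite ftype_closed. now apply ftype_star_type. Qed.

Lemma world_family Γ Δ s σ (φ : HA.form (σ :: Γ)) : world Γ Δ s ->
  has_type Δ (sub s (Lam (ftype_star σ) (form_star φ))) (Pi (sub s (ftype_star σ)) (U 0)).
Proof.
  intros [W H]. apply (has_type_sub (ctx_star Γ) _ (Pi (ftype_star σ) (U 0)) _ _); auto.
  apply ty_lam, (form_star_type (_ :: _)).
Qed.

Lemma family_beta Γ Δ s σ (φ : HA.form (σ :: Γ)) t : world Γ Δ s ->
  has_type Δ t (ftype_star σ) ->
  def_eq Δ (App (sub s (Lam (ftype_star σ) (form_star φ))) t)
           (sub (scons t s) (form_star φ)) (U 0).
Proof.
  intros [W H] Ht. apply (beta_sub (ctx_star Γ) Δ s _ _ (U 0) 0);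
    auto using ftype_star_type, ctx_star_wf.
  - apply (form_star_type (_ :: _)).
  - now rewrite ftype_closed.
Qed.

Lemma forces_wk Γ Δ s (φ : HA.form Γ) A : wf (A :: Δ) -> forces Δ s φ ->
  forces (A :: Δ) (wk_sub s) φ.
Proof. unfold forces; rewrite sub_wk_sub; apply inh_wk. Qed.

Lemma forces_inst Γ Δ s σ (φ : HA.form (σ :: Γ)) t :
  forces Δ s (HA.inst φ t) <-> forces Δ (scons (sub s (tm_star t)) s) φ.
Proof.
  unfold forces, HA.inst. erewrite sub_form_sub; [reflexivity | |].
  - apply star_subst_scons; intros τ v; reflexivity.
  - intros [|n]; reflexivity.
Qed.

Lemma forces_isProp Γ Δ s (φ : HA.form Γ) : world Γ Δ s ->
  inhabited Δ (isProp (sub s (form_star φ))).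
Proof.
  intros [W H]. destruct (form_isProp Γ φ) as [t Ht].
  exists (sub s t). now apply (has_type_sub _ _ _ _ _ Ht).
Qed.

(** * Forcing of the connectives *)

Lemma forces_bot Γ Δ s (φ : HA.form Γ) : world Γ Δ s ->
  forces Δ s (@HA.Bot Γ) -> forces Δ s φ.
Proof.
  intros E [t Ht].
  apply (holds_instance EMPTY_E _ [_; t] empty_e_holds (proj1 E)); auto using world_form.
Qed.

Lemma forces_and Γ Δ s (φ ψ : HA.form Γ) : world Γ Δ s ->
  (forces Δ s (HA.And φ ψ) <-> forces Δ s φ /\ forces Δ s ψ).
Proof.
  intros E. unfold forces; cbn [form_star]; rewrite times_sub. split.
  - intros [t Ht]; split.
    + apply (holds_instance AND_E1 _ [_; sub s (form_star ψ); t] and_e1_holds (proj1 E));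
        auto using world_form.
    + apply (holds_instance AND_E2 _ [sub s (form_star φ); _; t] and_e2_holds (proj1 E));
        auto using world_form.
  - intros [[a Ha] [b Hb]].
    apply (holds_instance AND_I _ [_; _; a; b] and_i_holds (proj1 E)); auto using world_form.
Qed.

Lemma forces_or_intro Γ Δ s (φ ψ : HA.form Γ) : world Γ Δ s ->
  forces Δ s φ \/ forces Δ s ψ -> forces Δ s (HA.Or φ ψ).
Proof.
  intros E [[a Ha]|[a Ha]].
  - apply (holds_instance OR_I1 _ [_; _; a] or_i1_holds (proj1 E)); auto using world_form.
  - apply (holds_instance OR_I2 _ [_; _; a] or_i2_holds (proj1 E)); auto using world_form.
Qed.

Lemma forces_imp Γ Δ s (φ ψ : HA.form Γ) : world Γ Δ s ->
  (forces Δ s (HA.Imp φ ψ) <->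
   forces (sub s (form_star φ) :: Δ) (wk_sub s) ψ).
Proof.
  intros E. unfold forces; cbn [form_star]; rewrite arr_sub, sub_wk_sub. split.
  - intros H. apply inh_pi_inv; auto. eapply wf_cons, world_form, E.
  - intros H. now apply inh_pi.
Qed.

Lemma forces_imp_elim Γ Δ s (φ ψ : HA.form Γ) :
  forces Δ s (HA.Imp φ ψ) -> forces Δ s φ -> forces Δ s ψ.
Proof. unfold forces; cbn [form_star]; rewrite arr_sub. apply inh_app. Qed.

Lemma forces_hyp Γ Δ s (φ : HA.form Γ) : world Γ Δ s ->
  forces (sub s (form_star φ) :: Δ) (wk_sub s) φ.
Proof.
  intros E. unfold forces; rewrite sub_wk_sub. exists (Var 0).
  apply (ty_var _ 0); auto. eapply wf_cons, world_form, E.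
Qed.

Lemma forces_or_elim Γ Δ s (φ ψ χ : HA.form Γ) : world Γ Δ s ->
  forces Δ s (HA.Or φ ψ) -> forces Δ s (HA.Imp φ χ) -> forces Δ s (HA.Imp ψ χ) ->
  forces Δ s χ.
Proof.
  unfold forces; cbn [form_star]; rewrite !arr_sub. intros E [t Ht] [f Hf] [g Hg].
  destruct (forces_isProp Γ Δ s χ E) as [h Hh].
  apply (holds_instance OR_E _
    [sub s (form_star φ); sub s (form_star ψ); _; h; t; f; g] or_e_holds (proj1 E));
    auto using world_form.
Qed.

Lemma forces_all Γ Δ s σ (φ : HA.form (σ :: Γ)) : world Γ Δ s ->
  (forces Δ s (HA.All σ φ) <-> forces (ftype_star σ :: Δ) (up s) φ).
Proof.
  intros E. unfold forces; cbn [form_star sub]; rewrite ftype_closed. split.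
  - intros H. apply inh_pi_inv; auto. eapply wf_cons, ftype_star_type, E.
  - apply inh_pi.
Qed.

Lemma forces_all_elim Γ Δ s σ (φ : HA.form (σ :: Γ)) a :
  has_type Δ a (ftype_star σ) ->
  forces Δ s (HA.All σ φ) -> forces Δ (scons a s) φ.
Proof.
  unfold forces; cbn [form_star sub]; rewrite ftype_closed. intros Ha [f Hf].
  exists (App f a). rewrite <- inst_up. eapply ty_app; eauto.
Qed.

Lemma forces_ex_intro Γ Δ s σ (φ : HA.form (σ :: Γ)) a : world Γ Δ s ->
  has_type Δ a (ftype_star σ) ->
  forces Δ (scons a s) φ -> forces Δ s (HA.Ex σ φ).
Proof.
  intros E Ha H.
  destruct (inh_conv _ _ _ _ H (eq_sym _ _ _ _ (family_beta Γ Δ s σ φ a E Ha)))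
    as [b Hb].
  apply (holds_instance EX_I _
    [sub s (ftype_star σ); sub s (Lam (ftype_star σ) (form_star φ)); a; b]
    ex_i_holds (proj1 E));
    eauto using world_ftype, world_family.
  cbn. now rewrite ftype_closed.
Qed.

Lemma forces_ex_elim Γ Δ s σ (φ : HA.form (σ :: Γ)) (χ : HA.form Γ) : world Γ Δ s ->
  forces Δ s (HA.Ex σ φ) -> forces Δ s (HA.All σ (HA.Imp φ (HA.wk χ))) ->
  forces Δ s χ.
Proof.
  intros E [t Ht] H.
  destruct (forces_isProp Γ Δ s χ E) as [h Hh].
  assert (E' := world_up Γ Δ s σ E).
  apply forces_all in H; auto.
  unfold forces in H; cbn [form_star] in H. rewrite arr_sub, form_star_wk, up_shift in H.
  assert (Eq : def_eq (ftype_star σ :: Δ)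
    (App (shift 1 (sub s (Lam (ftype_star σ) (form_star φ)))) (Var 0))
    (sub (up s) (form_star φ)) (U 0)).
  { rewrite <- sub_wk_sub, sub_up. apply family_beta.
    - split; [apply E'|]. apply sub_ok_wk; [apply E | apply E'].
    - rewrite <- (shift_ftype 1 σ) at 2. apply (ty_var _ 0); auto. apply E'. }
  assert (K : inhabited Δ (Pi (ftype_star σ)
    (arr (App (shift 1 (sub s (Lam (ftype_star σ) (form_star φ)))) (Var 0))
         (shift 1 (sub s (form_star χ)))))).
  { apply inh_pi. eapply inh_conv; [exact H|].
    apply eq_pi; [apply world_form, E' | apply eq_sym, Eq | apply eq_refl].
    apply (has_type_wk _ _ (U 0)); [eapply wf_cons, world_form, E' |].
    apply (has_type_wk _ _ (U 0)); [apply E' | apply world_form, E]. }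
  destruct K as [k Hk].
  apply (holds_instance EX_E _
    [sub s (ftype_star σ); sub s (Lam (ftype_star σ) (form_star φ)); _; h; t; k]
    ex_e_holds (proj1 E));
    eauto using world_ftype, world_form, world_family.
  cbn in *. now rewrite ftype_closed in *.
Qed.

(** * Forcing of the axioms *)

Lemma forces_eq Γ Δ s σ (t u : HA.tm Γ σ) :
  forces Δ s (HA.Eq t u) <->
  inhabited Δ (Id (ftype_star σ) (sub s (tm_star t)) (sub s (tm_star u))).
Proof.
  unfold forces; cbn [form_star]; unfold Id; cbn [sub]; now rewrite ftype_closed.
Qed.

Lemma forces_refl Γ Δ s σ (t : HA.tm Γ σ) : world Γ Δ s -> forces Δ s (HA.Eq t t).
Proof.
  intros E; apply forces_eq. destruct E as [W H].
  eexists. apply (const_instance _ (cRefl 0) [_; _] W); simpl;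
   auto using ftype_star_type. apply world_term; now split.
Qed.

Lemma forces_sym Γ Δ s σ (t u : HA.tm Γ σ) : world Γ Δ s ->
  forces Δ s (HA.Eq t u) -> forces Δ s (HA.Eq u t).
Proof.
  intros E; rewrite !forces_eq. intros [p Hp]. assert (W := proj1 E).
  apply (holds_instance SYM _ [_; _; _; p] sym_holds W);
    eauto using ftype_star_type, world_term.
Qed.

Lemma forces_trans Γ Δ s σ (t u v : HA.tm Γ σ) : world Γ Δ s ->
  forces Δ s (HA.Eq t u) -> forces Δ s (HA.Eq u v) -> forces Δ s (HA.Eq t v).
Proof.
  intros E; rewrite !forces_eq. intros [p Hp] [q Hq]. assert (W := proj1 E).
  apply (holds_instance TRANS _ [_; _; sub s (tm_star u); _; p; q] trans_holds W);
    eauto using ftype_star_type, world_term.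
Qed.

Lemma forces_cong Γ Δ s σ τ (t t' : HA.tm Γ (Arr σ τ)) (u u' : HA.tm Γ σ) :
  world Γ Δ s ->
  forces Δ s (HA.Eq t t') -> forces Δ s (HA.Eq u u') ->
  forces Δ s (HA.Eq (HA.App t u) (HA.App t' u')).
Proof.
  intros E; rewrite !forces_eq. intros [p Hp] [q Hq]. assert (W := proj1 E).
  pose proof (world_term _ _ _ _ t E). pose proof (world_term _ _ _ _ t' E).
  apply (holds_instance CONG _
    [ftype_star σ; ftype_star τ; sub s (tm_star t); sub s (tm_star t');
     sub s (tm_star u); sub s (tm_star u'); p; q] cong_holds W);
    eauto using ftype_star_type, world_term.
Qed.

Lemma forces_repl Γ Δ s σ (φ : HA.form (σ :: Γ)) (t u : HA.tm Γ σ) : world Γ Δ s ->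
  forces Δ s (HA.Eq t u) -> forces Δ s (HA.inst φ t) -> forces Δ s (HA.inst φ u).
Proof.
  intros E; rewrite forces_eq, !forces_inst. intros [p Hp] H. assert (W := proj1 E).
  pose proof (fun v => family_beta _ _ _ _ φ _ E (world_term _ _ _ _ v E)) as B.
  destruct (inh_conv _ _ _ _ H (eq_sym _ _ _ _ (B t))) as [a Ha].
  eapply inh_conv; [|exact (B u)].
  pose proof (world_family _ _ _ _ φ E) as HP. rewrite ftype_closed in HP.
  apply (holds_instance REPL _ [ftype_star σ; _; sub s (tm_star t); sub s (tm_star u); p; a]
    repl_holds W); eauto using ftype_star_type, world_term.
Qed.

Lemma forces_zero_succ Γ Δ s (t : HA.tm Γ N) : world Γ Δ s ->
  forces Δ s (HA.Neg (HA.Eq (HA.succ t) HA.zero)).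
Proof.
  intros E. apply (holds_instance ZERO_SUCC _ [sub s (tm_star t)] zero_succ_holds (proj1 E)).
  exact (world_term _ _ _ _ t E).
Qed.

Lemma forces_succ_inj Γ Δ s (t u : HA.tm Γ N) : world Γ Δ s ->
  forces Δ s (HA.Imp (HA.Eq (HA.succ t) (HA.succ u)) (HA.Eq t u)).
Proof.
  intros E. unfold forces; cbn [form_star]; rewrite arr_sub.
  apply (holds_instance SUCC_INJ _ [sub s (tm_star t); sub s (tm_star u)]
           succ_inj_holds (proj1 E)).
  - exact (world_term _ _ _ _ t E).
  - exact (world_term _ _ _ _ u E).
Qed.

(** The terms of the arithmetic are generalized first, so that computing the instance of
    the fact does not unfold their translations. *)
Tactic Notation "computation_rule" constr(T) uconstr(args) constr(H) :=
  let I := fresh in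
  let E := fresh in
  let W := fresh in
  intros E; assert (W := proj1 E); rewrite forces_eq;
  unfold HA.app2, HA.app3, HA.zero, HA.succ; cbn [tm_star sub];
  rewrite !const_star_closed;
  repeat match goal with
  | t : HA.tm _ _ |- _ =>
      let K := fresh in pose proof (world_term _ _ _ _ t ltac:(eassumption)) as K;
      rewrite ?arr_star, ?prod_star in K;
      revert K;
      match goal with |- context [sub ?s (tm_star t)] => generalize (sub s (tm_star t)) end;
      clear t; intros t K
  end;
  pose proof (holds_instance T _ args H ltac:(eassumption)) as I; cbn in I;
  rewrite ?ren_ftype in I; rewrite ?prod_star; apply I;
  try assumption; apply ftype_star_type; assumption.

Lemma forces_rec_zero Γ Δ s σ (a : HA.tm Γ σ) (b : HA.tm Γ (Arr σ (Arr N σ))) :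
  world Γ Δ s ->
  forces Δ s (HA.Eq (HA.app3 (HA.Const (HA.Rec σ)) a b HA.zero) a).
Proof. computation_rule REC_ZERO [ftype_star σ; a; b] rec_zero_holds. Qed.

Lemma forces_rec_succ Γ Δ s σ (a : HA.tm Γ σ) (b : HA.tm Γ (Arr σ (Arr N σ)))
  (n : HA.tm Γ N) : world Γ Δ s ->
  forces Δ s (HA.Eq (HA.app3 (HA.Const (HA.Rec σ)) a b (HA.succ n))
                  (HA.app2 b (HA.app3 (HA.Const (HA.Rec σ)) a b n) n)).
Proof. computation_rule REC_SUCC [ftype_star σ; a; b; n] rec_succ_holds. Qed.

Lemma forces_proj1 Γ Δ s σ τ (a : HA.tm Γ σ) (b : HA.tm Γ τ) : world Γ Δ s ->
  forces Δ s (HA.Eq (HA.App (HA.Const (HA.Proj1 σ τ))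
                       (HA.app2 (HA.Const (HA.Pair σ τ)) a b)) a).
Proof. computation_rule PROJ1_PAIR [ftype_star σ; ftype_star τ; a; b] proj1_pair_holds. Qed.

Lemma forces_proj2 Γ Δ s σ τ (a : HA.tm Γ σ) (b : HA.tm Γ τ) : world Γ Δ s ->
  forces Δ s (HA.Eq (HA.App (HA.Const (HA.Proj2 σ τ))
                       (HA.app2 (HA.Const (HA.Pair σ τ)) a b)) b).
Proof. computation_rule PROJ2_PAIR [ftype_star σ; ftype_star τ; a; b] proj2_pair_holds. Qed.

Lemma forces_surj_pair Γ Δ s σ τ (c : HA.tm Γ (Prod σ τ)) : world Γ Δ s ->
  forces Δ s (HA.Eq (HA.app2 (HA.Const (HA.Pair σ τ))
                       (HA.App (HA.Const (HA.Proj1 σ τ)) c)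
                       (HA.App (HA.Const (HA.Proj2 σ τ)) c)) c).
Proof. computation_rule SURJ_PAIR [ftype_star σ; ftype_star τ; c] surj_pair_holds. Qed.

Lemma forces_k Γ Δ s σ τ (a : HA.tm Γ σ) (b : HA.tm Γ τ) : world Γ Δ s ->
  forces Δ s (HA.Eq (HA.app2 (HA.Const (HA.K σ τ)) a b) a).
Proof. computation_rule K_EQ [ftype_star σ; ftype_star τ; a; b] k_eq_holds. Qed.

Lemma forces_s Γ Δ s ρ σ τ (a : HA.tm Γ (Arr ρ (Arr σ τ))) (b : HA.tm Γ (Arr ρ σ))
  (c : HA.tm Γ ρ) : world Γ Δ s ->
  forces Δ s (HA.Eq (HA.app3 (HA.Const (HA.S ρ σ τ)) a b c)
                (HA.app2 a c (HA.App b c))).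
Proof.
  computation_rule S_EQ [ftype_star ρ; ftype_star σ; ftype_star τ; a; b; c] s_eq_holds.
Qed.

Lemma at_succ_star Γ s (φ : HA.form (N :: Γ)) n :
  sub (scons n s) (form_star (HA.at_succ φ)) =
  sub (scons (App (Const cSucc) n) s) (form_star φ).
Proof.
  unfold HA.at_succ. eapply sub_form_sub.
  - apply star_subst_scons. intros σ v.
    instantiate (1 := fun n => Var (S n)); reflexivity.
  - intros [|m]; reflexivity.
Qed.

Lemma world_var0 Γ Δ s σ : world Γ Δ s ->
  has_type (ftype_star σ :: Δ) (Var 0) (ftype_star σ).
Proof.
  intros E. rewrite <- (shift_ftype 1 σ) at 2. apply (ty_var _ 0); auto.
  eapply wf_cons, ftype_star_type, E.
Qed.

Lemma forces_up Γ Δ s σ (φ : HA.form (σ :: Γ)) :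
  forces Δ (up s) φ <-> forces Δ (scons (Var 0) (wk_sub s)) φ.
Proof. unfold forces; now rewrite sub_up. Qed.

Lemma arr_cong Γ A A' B B' : wf Γ -> has_type Γ A (U 0) ->
  def_eq Γ A A' (U 0) -> def_eq Γ B B' (U 0) ->
  def_eq Γ (arr A B) (arr A' B') (U 0).
Proof.
  intros W HA EA EB. assert (W' := wf_cons _ _ _ HA).
  apply eq_pi; auto. rewrite !shift_wk_sub.
  apply (def_eq_sub _ _ _ (U 0) _ _ EB W'). apply sub_ok_wk; auto using sub_ok_id.
Qed.

Lemma forces_induction Γ Δ s (φ : HA.form (N :: Γ)) : world Γ Δ s ->
  forces Δ s (HA.inst φ HA.zero) -> forces Δ s (HA.All N (HA.Imp φ (HA.at_succ φ))) ->
  forces Δ s (HA.All N φ).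
Proof.
  intros E H0 HS. assert (W := proj1 E).
  assert (E' := world_up _ _ _ N E).
  assert (E1 : world Γ (ftype_star N :: Δ) (wk_sub s))
    by eauto using world_wk, ftype_star_type.
  assert (H1 := world_var0 _ _ _ N E).
  (* the eliminator is applied to the family P, and its results are β-reduced to φ *)
  set (P := sub s (Lam (ftype_star N) (form_star φ))).
  assert (HP : has_type Δ P (Pi Nat (U 0))) by exact (world_family _ _ _ _ φ E).
  assert (B : forall n, has_type (Nat :: Δ) n Nat ->
    def_eq (Nat :: Δ) (App (shift 1 P) n) (sub (scons n (wk_sub s)) (form_star φ)) (U 0)).
  { intros n Hn. unfold P. rewrite <- sub_wk_sub. now apply (family_beta _ _ _ _ φ n E1). }
  apply forces_inst in H0.
  destruct (inh_conv _ _ _ _ H0 (eq_sym _ _ _ _ (family_beta _ _ _ _ φ _ E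
     (world_term _ _ _ _ HA.zero E)))) as [z Hz].
  assert (K : inhabited Δ (Pi Nat (Pi (App (shift 1 P) (Var 0))
    (shift 1 (App (shift 1 P) (App (Const cSucc) (Var 0))))))).
  { apply inh_pi. apply forces_all in HS; auto.
    unfold forces in HS; cbn [form_star] in HS; rewrite arr_sub in HS.
    eapply inh_conv; [exact HS|]. apply arr_cong; [apply E' | apply world_form, E' | |].
    - rewrite sub_up. exact (eq_sym _ _ _ _ (B _ H1)).
    - rewrite sub_up.
      assert (HS1 : has_type (Nat :: Δ) (App (Const cSucc) (Var 0)) Nat).
      { exact (world_term _ _ _ _ (HA.succ (HA.Var HA.vz)) E'). }
      apply eq_sym. rewrite at_succ_star. exact (B _ HS1). }
  destruct K as [k Hk].
  apply forces_all; auto. apply inh_pi_inv; [apply E'|].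
  eapply inh_conv.
  - exists (App (App (App (Const (cNatInd 0)) P) z) k).
    apply (const_instance _ (cNatInd 0) [P; z; k] W); auto.
  - apply eq_pi; [exact (ftype_star_type _ N W) | apply eq_refl, (ftype_star_type _ N W) |].
    rewrite sub_up. exact (B _ H1).
Qed.

(** * Unique choice *)

Definition graph {Γ} (φ : HA.form (N :: N :: Γ)) : tm := Lam Nat (Lam Nat (form_star φ)).

Lemma graph_beta Γ Δ s (φ : HA.form (N :: N :: Γ)) a b : world Γ Δ s ->
  has_type Δ a Nat -> has_type Δ b Nat ->
  def_eq Δ (App (App (sub s (graph φ)) a) b)
           (sub (scons b (scons a s)) (form_star φ)) (U 0).
Proof.
  intros [W H] Ha Hb. assert (WΓ := ctx_star_wf Γ).
  apply (beta_sub2 (ctx_star Γ) Δ s Nat Nat _ 0 0); auto.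
  - exact (ftype_star_type _ N WΓ).
  - exact (ftype_star_type _ N (ctx_star_wf (N :: Γ))).
  - exact (form_star_type _ φ).
Qed.

Lemma graph_type Γ Δ s (φ : HA.form (N :: N :: Γ)) : world Γ Δ s ->
  has_type Δ (sub s (graph φ)) (Pi Nat (Pi Nat (U 0))).
Proof.
  intros [W H]. apply (has_type_sub (ctx_star Γ) _ (Pi Nat (Pi Nat (U 0))) _ _); auto.
  apply ty_lam, ty_lam, (form_star_type _ φ).
Qed.

Lemma graph_app_type Γ Δ s (φ : HA.form (N :: N :: Γ)) a b : world Γ Δ s ->
  has_type Δ a Nat -> has_type Δ b Nat ->
  has_type Δ (App (App (sub s (graph φ)) a) b) (U 0).
Proof.
  intros E Ha Hb. apply (ty_app _ Nat (U 0)); auto.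
  apply (ty_app _ Nat (Pi Nat (U 0))); auto. now apply graph_type.
Qed.

Lemma at_graph_star Γ s f n (φ : HA.form (N :: N :: Γ)) :
  sub (scons n (scons f s)) (form_star (HA.at_graph φ)) =
  sub (scons (App f n) (scons n s)) (form_star φ).
Proof.
  unfold HA.at_graph. eapply sub_form_sub.
  - do 2 apply star_subst_scons. intros σ v.
    instantiate (1 := fun n => Var (S (S n))); reflexivity.
  - intros [|[|m]]; reflexivity.
Qed.

Lemma forces_unique Γ Δ s (φ : HA.form (N :: Γ)) y z : world Γ Δ s ->
  has_type Δ y Nat -> has_type Δ z Nat ->
  forces Δ s (HA.ExU N φ) -> forces Δ (scons y s) φ -> forces Δ (scons z s) φ ->
  inhabited Δ (Id Nat y z).
Proof.
  intros E Hy Hz H Fy Fz. apply forces_and in H as [_ H]; auto.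
  apply (forces_all_elim _ _ _ N _ y) in H; auto.
  apply (forces_all_elim _ _ _ N _ z) in H; auto.
  refine (forces_imp_elim _ _ _ _ (HA.Eq (HA.Var (HA.vs HA.vz)) (HA.Var HA.vz)) H _).
  assert (E' : world (N :: N :: Γ) Δ (scons z (scons y s))).
  { apply world_cons; auto. now apply world_cons. }
  apply forces_and; auto. split; unfold forces in *.
  - erewrite sub_form_sub; [exact Fy | |].
    + apply star_subst_scons. intros σ v.
      instantiate (1 := fun n => Var (S (S n))); reflexivity.
    + intros [|n]; reflexivity.
  - erewrite sub_form_sub; [exact Fz | |].
    + apply star_subst_scons. intros σ v.
      instantiate (1 := fun n => Var (S (S n))); reflexivity.
    + intros [|n]; reflexivity.
Qed.

Lemma world_wk_nat Γ Δ s : world Γ Δ s -> world Γ (Nat :: Δ) (wk_sub s).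
Proof. intros E; eapply world_wk; [exact E | exact (ftype_star_type _ N (proj1 E))]. Qed.

Lemma forces_unique_choice Γ Δ s (φ : HA.form (N :: N :: Γ)) : world Γ Δ s ->
  forces Δ s (HA.All N (HA.ExU N φ)) ->
  forces Δ s (HA.Ex (Arr N N) (HA.All N (HA.at_graph φ))).
Proof.
  intros E H. assert (W := proj1 E).
  assert (E1 := world_wk_nat _ _ _ E). assert (E2 := world_wk_nat _ _ _ E1).
  assert (E3 := world_wk_nat _ _ _ E2).
  assert (V : forall Δ n, wf Δ -> nth_error Δ n = Some Nat -> has_type Δ (Var n) Nat).
  { intros Δ' n W' Hn. apply (ty_var _ _ _ W' Hn). }
  (* the four premises of the fact, with the relation [graph φ] *)
  assert (Hprop : inhabited Δ (Pi Nat (Pi Nat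
    (isProp (App (App (shift 1 (shift 1 (sub s (graph φ)))) (Var 1)) (Var 0)))))).
  { apply inh_pi, inh_pi. rewrite <- !sub_wk_sub.
    assert (B := graph_beta _ _ _ φ (Var 1) (Var 0) E2 (V _ 1 (proj1 E2) (Logic.eq_refl _))
       (V _ 0 (proj1 E2) (Logic.eq_refl _))).
    eapply inh_conv; [|apply isProp_cong; [apply E2 | apply eq_sym, B]].
    apply forces_isProp. apply (world_cons (N :: Γ)); [apply world_cons; auto|];
     apply V; auto; apply E2. }
  assert (Hex : inhabited Δ (Pi Nat (Trunc (App (App (Const (cSig 0)) Nat)
     (App (shift 1 (sub s (graph φ))) (Var 0)))))).
  { apply inh_pi. rewrite <- sub_wk_sub. apply forces_all in H; auto.
    apply forces_and in H as [H _]; [|now apply world_up].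
    eapply (inh_conv _ _ _ 0); [exact H|].
    change (def_eq (Nat :: Δ)
      (App (Const (cTrunc 0)) (App (App (Const (cSig 0)) Nat)
         (sub (up s) (Lam Nat (form_star φ)))))
      (App (Const (cTrunc 0)) (App (App (Const (cSig 0)) Nat)
         (App (sub (wk_sub s) (graph φ)) (Var 0))))
      (U 0)).
    apply (eq_app _ (U 0) (U 0)).
    { apply eq_refl. exact (const_instance _ (cTrunc 0) [] (proj1 E1)). }
    apply (eq_app _ (Pi Nat (U 0)) (U 0)).
    { apply eq_refl.
      exact (const_instance _ (cSig 0) [Nat] (proj1 E1) (ftype_star_type _ N (proj1 E1))). }
    rewrite sub_up. apply eq_sym.
    apply (beta_sub (ctx_star Γ) _ _ Nat (Lam Nat (form_star φ)) (Pi Nat (U 0)) 0);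
      try apply E1.
    - exact (ftype_star_type _ N (ctx_star_wf Γ)).
    - apply ty_lam, (form_star_type _ φ).
    - apply V; auto; apply E1. }
  assert (Huniq : inhabited Δ (Pi Nat (Pi Nat (Pi Nat
     (Pi (App (App (shift 1 (shift 1 (shift 1 (sub s (graph φ))))) (Var 2)) (Var 1))
      (Pi (App (App (shift 1 (shift 1 (shift 1 (shift 1 (sub s (graph φ)))))) (Var 3)) (Var 1))
         (Id Nat (Var 3) (Var 2)))))))).
  {
    (* the context is extended by x, y, z and the two hypotheses Q x y and Q x z *)
    do 5 apply inh_pi. rewrite <- !sub_wk_sub.
    match goal with |- inhabited (?A2 :: ?A1 :: _) _ =>
      assert (HA1 : has_type (Nat :: Nat :: Nat :: Δ) A1 (U 0));
        [|assert (E4 := world_wk _ _ _ _ _ E3 HA1);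
          assert (HA2 : has_type (A1 :: Nat :: Nat :: Nat :: Δ) A2 (U 0));
          [|assert (E5 := world_wk _ _ _ _ _ E4 HA2)]]
    end.
    - apply graph_app_type; auto; apply V; auto; apply E3.
    - apply graph_app_type; auto; apply V; auto; apply E4.
    - assert (V' := fun n => V _ n (proj1 E5)).
      pose proof (V' 4 (Logic.eq_refl _)) as V4.
      pose proof (V' 3 (Logic.eq_refl _)) as V3.
      pose proof (V' 2 (Logic.eq_refl _)) as V2.
      apply (forces_unique (N :: Γ) _
        (scons (Var 4) (wk_sub (wk_sub (wk_sub (wk_sub (wk_sub s)))))) φ); auto.
      + now apply world_cons.
      + apply (forces_all_elim _ _ _ N); auto.
        apply forces_wk; [apply E5|]. apply forces_wk; [apply E4|].
        apply forces_wk; [apply E3|]. apply forces_wk; [apply E2|].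
        apply forces_wk; [apply E1|]. exact H.
      + eapply inh_conv; [|exact (graph_beta _ _ _ φ _ _ E5 V4 V3)].
        exists (Var 1).
        refine (eq_ind _ (has_type _ (Var 1)) (ty_var _ 1 _ (proj1 E5) (Logic.eq_refl _)) _ _).
        rewrite !sub_wk_sub, ?(shift_S 1). reflexivity.
      + eapply inh_conv; [|exact (graph_beta _ _ _ φ _ _ E5 V4 V2)].
        exists (Var 0).
        refine (eq_ind _ (has_type _ (Var 0)) (ty_var _ 0 _ (proj1 E5) (Logic.eq_refl _)) _ _).
        rewrite !sub_wk_sub, ?(shift_S 1). reflexivity. }
  destruct Hprop as [h Hh], Hex as [e He], Huniq as [u Hu].
  set (χ := HA.Ex (Arr N N) (HA.All N (HA.at_graph φ))).
  assert (Hk : inhabited Δ (Pi (Pi Nat Nat)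
    (Pi (Pi Nat (App (App (shift 1 (shift 1 (sub s (graph φ)))) (Var 0)) (App (Var 1) (Var 0))))
     (shift 1 (shift 1 (sub s (form_star χ))))))).
  {
    (* the context is extended by f and the hypothesis that Q x (f x) for all x *)
    apply inh_pi, inh_pi. rewrite <- !sub_wk_sub.
    assert (F1 : world Γ (Pi Nat Nat :: Δ) (wk_sub s)).
    { eapply world_wk; [exact E | exact (ftype_star_type _ (Arr N N) W)]. }
    assert (F2 := world_wk_nat _ _ _ F1).
    match goal with |- inhabited (?T :: _) _ =>
      assert (HT : has_type (Pi Nat Nat :: Δ) T (U 0));
        [|assert (F3 := world_wk _ _ _ _ _ F1 HT)]
    end.
    { apply ty_pi; [exact (ftype_star_type _ N (proj1 F1))|].
      apply graph_app_type; auto; [apply V; auto; apply F2|].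
      apply (ty_app _ Nat Nat); [|apply V; auto; apply F2].
      exact (ty_var _ 1 _ (proj1 F2) (Logic.eq_refl _)). }
    assert (F4 := world_wk_nat _ _ _ F3).
    assert (V1 := ty_var _ 1 _ (proj1 F3) (Logic.eq_refl _)).
    apply (forces_ex_intro _ _ _ (Arr N N) _ (Var 1)); auto.
    apply forces_all; [now apply (world_cons Γ _ _ (Arr N N))|].
    apply forces_up. unfold forces.
    rewrite (sub_ext (scons (Var 0) (wk_sub (scons (Var 1) (wk_sub (wk_sub s)))))
      (scons (Var 0) (scons (Var 2) (wk_sub (wk_sub (wk_sub s)))))) by
      (intros [|[|n]]; reflexivity).
    rewrite at_graph_star.
    eapply inh_conv; [|apply graph_beta; auto].
    - apply inh_pi_inv; [apply F4|]. exists (Var 0).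
      refine (eq_ind _ (has_type _ (Var 0)) (ty_var _ 0 _ (proj1 F3) (Logic.eq_refl _)) _ _).
      unfold shift; cbn [ren]. rewrite (sub_wk_sub (wk_sub (wk_sub s))).
      rewrite (sub_wk_sub (wk_sub s)), ren_up_shift. reflexivity.
    - apply V; auto; apply F4.
    - apply (ty_app _ Nat Nat); [|apply V; auto; apply F4].
      exact (ty_var _ 2 _ (proj1 F4) (Logic.eq_refl _)). }
  destruct Hk as [k Hk].
  apply (holds_instance UNIQUE_CHOICE _ [Nat; Nat; sub s (graph φ); h; e; u;
    sub s (form_star χ); k] unique_choice_holds W); auto using graph_type, world_form;
    exact (ftype_star_type _ N W).
Qed.

(** * Soundness *)

(** A premise of a rule holds at every world, in particular at the extension of the
    given world by the variable or the hypothesis that the rule discharges. *)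
Theorem soundness Γ H (φ : HA.form Γ) : HA.prf Γ H φ ->
  forall Δ s, world Γ Δ s -> (forall ψ, In ψ H -> forces Δ s ψ) -> forces Δ s φ.
Proof.
  induction 1; intros Δ s E HH.
  - auto.
  - eauto using forces_bot.
  - apply forces_and; auto.
  - apply (forces_and _ _ _ φ ψ); auto.
  - apply (forces_and _ _ _ φ ψ); auto.
  - apply forces_or_intro; auto.
  - apply forces_or_intro; auto.
  - assert (imp : forall θ, (forall Δ s, world Γ Δ s ->
      (forall ψ, In ψ (θ :: H) -> forces Δ s ψ) -> forces Δ s χ) ->
      forces Δ s (HA.Imp θ χ)).
    { intros θ IH. apply forces_imp; auto.
      assert (E' := world_wk _ _ _ _ _ E (world_form _ _ _ θ E)).
      apply IH; auto. intros ψ' [<-|Hψ]; [now apply forces_hyp|].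
      apply forces_wk; [apply E' | auto]. }
    apply (forces_or_elim _ _ _ φ ψ χ); auto.
  - apply forces_imp; auto.
    assert (E' := world_wk _ _ _ _ _ E (world_form _ _ _ φ E)).
    apply IHprf; auto. intros ψ' [<-|Hψ]; [now apply forces_hyp|].
    apply forces_wk; [apply E' | auto].
  - eapply forces_imp_elim; eauto.
  - apply forces_all; auto. assert (E' := world_up _ _ _ σ E).
    apply IHprf; auto. intros ψ (ψ' & <- & Hψ)%in_map_iff.
    unfold forces; rewrite form_star_wk, up_shift. apply inh_wk; [apply E' | now apply HH].
  - apply forces_inst, forces_all_elim; auto. now apply world_term.
  - eapply forces_ex_intro; [auto | apply world_term; eauto |]. apply forces_inst; auto.
  - apply (forces_ex_elim _ _ _ σ φ ψ); auto.
    apply forces_all; auto. assert (E' := world_up _ _ _ σ E).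
    apply forces_imp; auto.
    assert (E'' := world_wk _ _ _ _ _ E' (world_form _ _ _ φ E')).
    apply IHprf2; auto. intros ψ' [<-|(ψ'' & <- & Hψ)%in_map_iff]; [now apply forces_hyp|].
    apply forces_wk; [apply E''|].
    unfold forces; rewrite form_star_wk, up_shift. apply inh_wk; [apply E' | now apply HH].
  - now apply forces_refl.
  - apply forces_sym; auto.
  - eapply forces_trans; eauto.
  - apply forces_cong; auto.
  - eapply forces_repl; eauto.
  - now apply forces_zero_succ.
  - now apply forces_succ_inj.
  - apply forces_induction; auto.
  - now apply forces_rec_zero.
  - now apply forces_rec_succ.
  - now apply forces_proj1.
  - now apply forces_proj2.
  - now apply forces_surj_pair.
  - now apply forces_k.
  - now apply forces_s.
  - apply forces_unique_choice; auto. apply IHprf; auto. intros ψ [].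
Qed.

Theorem proposition5p5 :
  (exists p : ftype -> HoTT.tm,
     forall σ : ftype,
       HoTT.has_type [] (Star.ftype_star σ) (HoTT.U 0) /\
       HoTT.has_type [] (p σ) (HoTT.isSet (Star.ftype_star σ))) /\
  (forall (Γ : HA.ctx) (σ : ftype) (t : HA.tm Γ σ),
     HoTT.has_type (Star.ctx_star Γ) (Star.tm_star t) (Star.ftype_star σ)) /\
  (forall (Γ : HA.ctx) (φ : HA.form Γ),
     HoTT.has_type (Star.ctx_star Γ) (Star.form_star φ) (HoTT.U 0) /\
     HoTT.inhabited (Star.ctx_star Γ) (HoTT.isProp (Star.form_star φ))) /\
  (forall (Γ : HA.ctx) (φ : HA.form Γ),
     HA.derivable φ ->
     HoTT.inhabited (Star.ctx_star Γ) (Star.form_star φ)).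
Proof.
  split; [|split; [|split]].
  - destruct ftype_isSet as [p Hp]. exists p; auto using ftype_star_type, wf_nil.
  - exact tm_star_type.
  - auto using form_star_type, form_isProp.
  - intros Γ φ D. rewrite <- (sub_id Var (form_star φ)) by auto.
    apply (soundness Γ [] φ D).
    + split; auto using sub_ok_id, ctx_star_wf.
    + intros ψ [].
Qed.
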